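(* Let $f:\mathbb{R}\to\mathbb{R}_+\cup\{\infty\}$ be a nonnegative, proper, closed, convex and essentially smooth function, and suppose there is a finite set $W\subset \mathrm{int}(\mathrm{dom}\,f)$ such that $f$ is strongly convex on every compact convex subset of $\mathrm{int}(\mathrm{dom}\,f)\setminus W$ and $f'$ is locally Lipschitz continuous on every convex subset of $\mathrm{int}(\mathrm{dom}\,f)\setminus W$. Let $\mathcal{K}=\mathrm{epi}\,f^\pi\subset\mathbb{R}^3$ be the epigraph of the closed perspective function of $f$ and $\mathcal{K}^*$ its dual cone. Then, for any $s>1$, for $\mathcal{H}^s$-almost every $\mathbf{z}^*\in\mathrm{bdry}(\mathcal{K}^* )$, the one-step facial residual function for $\mathcal{K}$ and $\mathbf{z}^*$ can be taken to be H\''olderian of exponent $1/2$ (that is, $\mathcal{K}$ and $\mathbf{z}^*$ admit a H\''olderian 1-FRF of exponent $1/2$, for all $\mathbf{z}^*\in \mathrm{bdry}(\mathcal{K}^* )$ outside a set $A$ with $\mathcal{H}^s(A)=0$).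
   Context: $\mathbb{R}^3$ carries the standard inner product. A proper convex $f:\mathbb{R}\to\mathbb{R}\cup\{\infty\}$ is essentially smooth if $\mathrm{int}(\mathrm{dom}\,f)\neq\emptyset$, $f$ is differentiable on $\mathrm{int}(\mathrm{dom}\,f)$, and $|f'(x^k)|\to\infty$ whenever $\{x^k\}\subset\mathrm{int}(\mathrm{dom}\,f)$ converges to a point of $\mathrm{bdry}(\mathrm{dom}\,f)$. ''Closed'' means lower semicontinuous. Recession function: $f_\infty(d)=\lim_{t\to\infty}\frac{f(y+td)-f(y)}{t}$ for any fixed $y\in\mathrm{dom}\,f$ (independent of $y$). Closed perspective: $f^\pi(x,t)=t f(x/t)$ if $t>0$, $f_\infty(x)$ if $t=0$, $\infty$ if $t<0$. Its epigraph is the closed convex cone $\mathrm{epi}\,f^\pi=\{(x,t,r)\in\mathbb{R}^3: r\ge f^\pi(x,t)\}$. Dual cone: $\mathcal{K}^*=\{\mathbf{y}:\langle \mathbf{x},\mathbf{y}\rangle\ge 0\ \forall \mathbf{x}\in\mathcal{K}\}$. 1-FRF: for a closed convex cone $\mathcal{K}$ and $\mathbf{z}\in\mathcal{K}^*$, a function $\psi:\mathbb{R}_+\times\mathbb{R}_+\to\mathbb{R}_+$ is a one-step facial residual function (1-FRF) for $\mathcal{K}$ and $\mathbf{z}$ if (i) $\psi$ is nonnegative, nondecreasing in each argument and $\psi(0,t)=0$ for all $t\ge0$; (ii) for every $\mathbf{x}\in\mathrm{span}(\mathcal{K})$ and $\epsilon\ge 0$: $\mathrm{d}(\mathbf{x},\mathcal{K})\le\epsilon$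 and $\langle\mathbf{x},\mathbf{z}\rangle\le\epsilon$ imply $\mathrm{d}(\mathbf{x},\mathcal{K}\cap\{\mathbf{z}\}^\perp)\le\psi(\epsilon,\|\mathbf{x}\|)$. It is H\''olderian of exponent $\alpha\in(0,1]$ if $\psi(\epsilon,t)=\rho_1(t)\epsilon+\rho_2(t)\epsilon^\alpha$ for some nonnegative nondecreasing $\rho_1,\rho_2:\mathbb{R}_+\to\mathbb{R}_+$. $\mathcal{H}^s$ is the $s$-dimensional Hausdorff measure: $\mathcal{H}^s(A)=\sup_{\delta>0}\inf\{\sum_{j\ge1}\mathrm{diam}(C_j)^s: A\subseteq\bigcup_j C_j,\ \mathrm{diam}(C_j)\le\delta\}$. *)

(* Defs.v *)
From mathcomp Require Import all_boot all_order all_algebra.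
From mathcomp Require Import all_classical all_reals all_analysis.

Set Implicit Arguments.
Unset Strict Implicit.
Unset Printing Implicit Defensive.

Import Order.TTheory GRing.Theory Num.Theory.
Import numFieldNormedType.Exports.

Local Open Scope classical_set_scope.
Local Open Scope ring_scope.

(* The library norm on ['rV[R]_n] is the sup norm, so the Euclidean norm and
   everything metric are defined explicitly; the topology is the same. *)
Section euclidean.
Context {R : realType} {n : nat}.
Implicit Types (x y z : 'rV[R]_n) (A K : set 'rV[R]_n).

Definition inner x y : R := \sum_i x 0 i * y 0 i.

Definition enorm x : R := Num.sqrt (inner x x).

Definition set_dist x A : \bar R := ereal_inf [set (enorm (x - a))%:E | a in A].

Definition bdry {T : topologicalType} (B : set T) : set T := closure B `\` B°.

Definition linear_span A : set 'rV[R]_n :=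
  [set x | exists (k : nat) (c : 'I_k -> R) (v : 'I_k -> 'rV[R]_n),
    (forall i, A (v i)) /\ x = \sum_i c i *: v i].

Definition dual_cone K : set 'rV[R]_n :=
  [set y | forall x, K x -> 0 <= inner x y].

Definition orthogonal_to z : set 'rV[R]_n := [set x | inner x z = 0].

(* The point [0] is added so that the empty set has diameter [0], not [-oo]. *)
Definition diam A : \bar R :=
  ereal_sup (0%E |` [set (enorm (x - y))%:E | x in A & y in A]).

Definition hausdorff_measure (s : R) A : \bar R :=
  ereal_sup [set ereal_inf
      [set (\sum_(0 <= j <oo) diam (C j) `^ s)%E |
        C in [set C : nat -> set 'rV[R]_n |
          A `<=` \bigcup_j C j /\ forall j, (diam (C j) <= d%:E)%E]] |
    d in [set d : R | 0 < d]].

End euclidean.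

(* Functions on [0, +oo) are represented by functions on [R], of which only the
   values at nonnegative arguments are ever constrained or used. *)
Section facial_residual.
Context {R : realType} {n : nat}.
Implicit Types (K : set 'rV[R]_n) (z : 'rV[R]_n) (psi : R -> R -> R).

Definition is_1FRF K z psi : Prop :=
  [/\ forall e t, 0 <= e -> 0 <= t -> 0 <= psi e t,
      forall e e' t, 0 <= e -> e <= e' -> 0 <= t -> psi e t <= psi e' t,
      forall e t t', 0 <= e -> 0 <= t -> t <= t' -> psi e t <= psi e t',
      forall t, 0 <= t -> psi 0 t = 0 &
      forall x e, linear_span K x -> 0 <= e ->
        (set_dist x K <= e%:E)%E -> inner x z <= e ->
        (set_dist x (K `&` orthogonal_to z) <= (psi e (enorm x))%:E)%E].

Definition hoelderian (alpha : R) psi : Prop :=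
  0 < alpha <= 1 /\
  exists rho1 rho2 : R -> R,
    [/\ forall t, 0 <= t -> 0 <= rho1 t /\ 0 <= rho2 t,
        forall t t', 0 <= t -> t <= t' ->
          rho1 t <= rho1 t' /\ rho2 t <= rho2 t' &
        forall e t, 0 <= e -> 0 <= t ->
          psi e t = rho1 t * e + rho2 t * e `^ alpha].

End facial_residual.

Section extended_functions.
Context {R : realType}.
Implicit Type f : R -> \bar R.

Definition effdom f : set R := [set x | (f x < +oo)%E].

Definition proper_efun f : Prop := effdom f !=set0 /\ forall x, (-oo < f x)%E.

Definition econvex f : Prop := forall (x y t : R), 0 < t -> t < 1 ->
  (f (t * x + (1 - t) * y)%R <= t%:E * f x + (1 - t)%:E * f y)%E.

(* [fine \o f] is the real-valued restriction of [f] to its domain. *)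
Definition fderiv f : R -> R := derive1 (fine \o f : R -> R).

Definition essentially_smooth f : Prop :=
  [/\ (effdom f)° !=set0,
      forall x, (effdom f)° x -> derivable (fine \o f : R -> R) x 1 &
      forall (u : nat -> R) (b : R), (forall k, (effdom f)° (u k)) ->
        u @ \oo --> b -> bdry (effdom f) b ->
        (fun k => `|fderiv f (u k)|) @ \oo --> +oo].

Definition strongly_convex_on (C : set R) (g : R -> R) : Prop :=
  exists2 sigma : R, 0 < sigma &
    forall x y t : R, C x -> C y -> 0 <= t -> t <= 1 ->
      g (t * x + (1 - t) * y) <=
        t * g x + (1 - t) * g y - sigma / 2 * (t * (1 - t)) * (x - y) ^+ 2.

Definition locally_lipschitz_on (C : set R) (g : R -> R) : Prop :=
  forall x, C x ->
    exists2 U : set R, nbhs x U & [lipschitz g y | y in U `&` C].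

(* For proper closed convex [f] the limit exists in the extended reals and does
   not depend on the base point, here an arbitrary element of [effdom f]. *)
Definition recession f (d : R) : \bar R :=
  let y := xget 0 (effdom f) in
  lim ((f (y + t * d)%R - f y) * (t^-1)%:E @[t --> +oo%R])%E.

Definition perspective f (x t : R) : \bar R :=
  if 0 < t then (t%:E * f (x / t)%R)%E
  else if t == 0 then recession f x else +oo%E.

Definition epi_perspective f : set 'rV[R]_3 :=
  [set v | (perspective f (v 0 0)%R (v 0 1)%R <= (v 0 2)%R%:E)%E].

End extended_functions.

(* Main.v *)
(* Write [F] for the finite part of [f], [I] for the interior of its domain and,
   for [z = (a, b, c)], [h y = a y + b + c F y], so that [z] lies in the dual
   cone iff [c >= 0] and [h >= 0] on the domain. A point [z] admits a Hoelderian
   residual function as soon as, with [q = <v, z>], the distance from every [v]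
   in the cone to the exposed face is [O(q + sqrt (|v| q))].

   For [c = 0] and [a y + b] bounded below by a positive constant, the face is
   the vertical ray and the bound is linear. For [c > 0] there are two cases,
   according to the sign of [h' = a + c F'] on [I].
   - [h'] vanishes at [x0]. If [h x0 > 0] then [z] is interior to the dual cone.
     If [h x0 = 0] and [x0] is not in [W], strong convexity near [x0] makes [h]
     grow quadratically near [x0] and linearly far from it, whence the square
     root.
   - [h'] has a constant sign. Essential smoothness makes the domain unbounded in
     the direction in which [h] decreases; if [inf h > 0] the face is a ray at
     infinity and the bound is linear.
   What is left ([a = c = 0], [inf h = 0] in the first or the last case, [x0] in
   [W]) is a finite union of rays, which is H^s-null for [s > 1]. *)

Require Import Defs.
From mathcomp Require Import all_boot all_order all_algebra.
From mathcomp Require Import all_classical all_reals all_analysis.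
From mathcomp Require Import ring lra.

Set Implicit Arguments.
Unset Strict Implicit.
Unset Printing Implicit Defensive.

Import Order.TTheory GRing.Theory Num.Theory.
Import numFieldNormedType.Exports.

Local Open Scope classical_set_scope.
Local Open Scope ring_scope.

(** * Residual bounds in the l1 norm *)

Section l1_norm.
Context {R : realType}.
Implicit Types (u v : 'rV[R]_3) (F : 'I_3 -> R).

Lemma sum_ord3 F : \sum_i F i = F 0 + F 1 + F 2.
Proof.
rewrite !big_ord_recl big_ord0 addr0 addrA.
by congr (F _ + F _ + F _); apply: val_inj.
Qed.

Lemma inner3 u v : inner u v = u 0 0 * v 0 0 + u 0 1 * v 0 1 + u 0 2 * v 0 2.
Proof. exact: sum_ord3. Qed.

Definition vec3 (x t r : R) : 'rV[R]_3 := \row_i [:: x; t; r]`_i.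

Lemma vec3E x t r :
  ((vec3 x t r 0 0 = x) * (vec3 x t r 0 1 = t) * (vec3 x t r 0 2 = r))%type.
Proof. by rewrite /vec3 !mxE. Qed.

Lemma eq_vec3 u v : u 0 0 = v 0 0 -> u 0 1 = v 0 1 -> u 0 2 = v 0 2 -> u = v.
Proof.
move=> e0 e1 e2; apply/rowP => -[[|[|[|//]]] i3].
- by rewrite (_ : Ordinal i3 = 0)//; exact: val_inj.
- by rewrite (_ : Ordinal i3 = 1)//; exact: val_inj.
- by rewrite (_ : Ordinal i3 = 2)//; exact: val_inj.
Qed.

(** The l1 norm allows coordinatewise estimates; it agrees with [enorm] up to a factor 3, which the
    constants absorb. *)
Definition norm1 u : R := `|u 0 0| + `|u 0 1| + `|u 0 2|.

Lemma norm1_ge0 u : 0 <= norm1 u.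
Proof. by rewrite /norm1 !addr_ge0. Qed.

Lemma ler_norm1D u v : norm1 (u + v) <= norm1 u + norm1 v.
Proof.
rewrite /norm1 !mxE.
have := ler_normD (u 0 0) (v 0 0); have := ler_normD (u 0 1) (v 0 1).
have := ler_normD (u 0 2) (v 0 2); lra.
Qed.

Lemma enorm_le_norm1 u : enorm u <= norm1 u.
Proof.
rewrite /enorm -[leRHS]ger0_norm ?norm1_ge0// -sqrtr_sqr ler_wsqrtr//.
rewrite inner3 /norm1 -!expr2 -(real_normK (num_real (u 0 0))).
rewrite -(real_normK (num_real (u 0 1))) -(real_normK (num_real (u 0 2))).
have := normr_ge0 (u 0 0); have := normr_ge0 (u 0 1).
have := normr_ge0 (u 0 2); nra.
Qed.

Lemma norm1_le_enorm u : norm1 u <= 3 * enorm u.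
Proof.
suff le i : `|u 0 i| <= enorm u.
  by rewrite /norm1; have := le 0; have := le 1; have := le 2; lra.
rewrite /enorm -sqrtr_sqr ler_wsqrtr// /inner (bigD1 i)//= -expr2 lerDl.
by apply: sumr_ge0 => j _; rewrite -expr2 sqr_ge0.
Qed.

Lemma inner_le_norm1 u v : `|inner u v| <= norm1 u * norm1 v.
Proof.
rewrite inner3; apply: (le_trans (ler_normD _ _)).
rewrite (le_trans (lerD (ler_normD _ _) (lexx _)))// !normrM /norm1.
have := normr_ge0 (u 0 0); have := normr_ge0 (u 0 1); have := normr_ge0 (u 0 2).
have := normr_ge0 (v 0 0); have := normr_ge0 (v 0 1); have := normr_ge0 (v 0 2).
nra.
Qed.

End l1_norm.

(** * From a bound on the cone to a Hoelderian residual function *)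

Section residual_of_bound.
Context {R : realType}.
Implicit Types (K : set 'rV[R]_3) (z v : 'rV[R]_3).

Lemma sqrtrD_le (x y : R) : 0 <= x -> 0 <= y ->
  Num.sqrt (x + y) <= Num.sqrt x + Num.sqrt y.
Proof.
move=> x0 y0; rewrite -[leRHS]ger0_norm ?addr_ge0 ?sqrtr_ge0//.
rewrite -sqrtr_sqr ler_wsqrtr// sqrrD !sqr_sqrtr//.
have := mulr_ge0 (sqrtr_ge0 x) (sqrtr_ge0 y); rewrite -mulr_natr; lra.
Qed.

(** A point [x] within [e] of the cone is replaced by a nearby [v] of the cone. This costs [O(e)] in
    the norm and in the inner product with [z], and the root splits into a multiple of
    [sqrt |x| * sqrt e] plus [O(e)]. *)
Lemma residual_of_bound K z (C : R) : 0 <= C ->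
  (forall v, K v -> exists2 p, (K `&` orthogonal_to z) p &
    norm1 (v - p) <= C * (inner v z + Num.sqrt (norm1 v * inner v z))) ->
  (forall v, K v -> 0 <= inner v z) ->
  exists2 psi : R -> R -> R, is_1FRF K z psi & hoelderian (1 / 2) psi.
Proof.
move=> C0 Kp Kz.
(* [B * e'] will bound [inner v z]: [inner x z] contributes at most [e'], and
   [norm1 (x - v) * norm1 z] at most [3 * e' * norm1 z]. *)
pose B : R := 1 + 3 * norm1 z.
have B0 : 0 <= B by rewrite /B addr_ge0// mulr_ge0// norm1_ge0.
pose D := C * Num.sqrt (3 * B).
have D0 : 0 <= D by rewrite mulr_ge0 ?sqrtr_ge0.
pose rho1 : R := 3 + C * B + D.
have rho10 : 0 <= rho1 by rewrite /rho1 !addr_ge0// mulr_ge0.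
pose rho2 (t : R) : R := D * Num.sqrt t.
have rho20 t : 0 <= rho2 t by rewrite mulr_ge0 ?sqrtr_ge0.
have rho2_mono (t t' : R) : t <= t' -> rho2 t <= rho2 t'.
  by move=> tt'; rewrite ler_wpM2l// ler_wsqrtr.
exists (fun e t => rho1 * e + rho2 t * Num.sqrt e); last first.
  split; first by lra.
  exists (fun=> rho1), rho2; split => [t _|t t' _ tt'|e t e0 _].
  - by split.
  - by split => //; exact: rho2_mono.
  - by rewrite mul1r powR12_sqrt.
split.
- by move=> e t e0 t0; rewrite addr_ge0 ?mulr_ge0 ?sqrtr_ge0.
- move=> e e' t e0 ee' t0; rewrite lerD ?ler_wpM2l//.
  by rewrite ler_wsqrtr.
- by move=> e t t' e0 t0 tt'; rewrite lerD2l ler_wpM2r ?sqrtr_ge0 ?rho2_mono.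
- by move=> t _; rewrite sqrtr0 !mulr0 addr0.
move=> x e _ e0 dxK xz.
(* The infimum defining the distance may fail to be attained, so [v] is found only for [e' > e]; the
   limit [e' -> e] is taken at the end. *)
have step e' : e < e' -> (set_dist x (K `&` orthogonal_to z) <=
    (rho1 * e' + rho2 (enorm x) * Num.sqrt e')%:E)%E.
  move=> ee'.
  have e'0 : 0 <= e' by lra.
  have /ereal_inf_lt[_ [v Kv <-]] : (set_dist x K < e'%:E)%E.
    by rewrite (le_lt_trans dxK)// lte_fin.
  rewrite lte_fin => xv.
  have [p Fp vp] := Kp v Kv.
  have nxv : norm1 (x - v) <= 3 * e'.
    by apply: (le_trans (norm1_le_enorm _)); rewrite ler_pM2l// ltW.
  apply: (@le_trans _ _ (enorm (x - p))%:E).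
    by apply/ereal_inf_lbound; exists p.
  rewrite lee_fin (le_trans (enorm_le_norm1 _))//.
  rewrite -(subrKA v) (le_trans (ler_norm1D _ _))//.
  have vz : inner v z <= B * e'.
    have -> : inner v z = inner x z - inner (x - v) z.
      by rewrite !inner3 !mxE; ring.
    have := le_trans (ler_norm _) (inner_le_norm1 (v - x) z).
    have -> : inner (v - x) z = - inner (x - v) z by rewrite !inner3 !mxE; ring.
    have -> : norm1 (v - x) = norm1 (x - v).
      by rewrite /norm1 !mxE -![_ - x _ _]opprB !normrN.
    by have := norm1_ge0 z; rewrite /B; nra.
  have nv : norm1 v <= 3 * (enorm x + e').
    rewrite (_ : v = x + (v - x)); last by rewrite addrC subrK.
    apply: (le_trans (ler_norm1D _ _)).
    have -> : norm1 (v - x) = norm1 (x - v).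
      by rewrite /norm1 !mxE -![_ - x _ _]opprB !normrN.
    by have := norm1_le_enorm x; lra.
  have ex0 : 0 <= enorm x by exact: sqrtr_ge0.
  have sq : Num.sqrt (norm1 v * inner v z) <=
      Num.sqrt (3 * B) * (Num.sqrt (enorm x) * Num.sqrt e' + e').
    apply: (@le_trans _ _ (Num.sqrt (3 * B * ((enorm x + e') * e')))).
      rewrite ler_wsqrtr//.
      rewrite (_ : 3 * B * _ = 3 * (enorm x + e') * (B * e')); last by ring.
      by rewrite ler_pM ?norm1_ge0 ?Kz.
    rewrite sqrtrM ?mulr_ge0// ler_wpM2l ?sqrtr_ge0// mulrDl.
    rewrite (le_trans (sqrtrD_le _ _)) ?mulr_ge0//.
    by rewrite sqrtrM// -expr2 sqrtr_sqr ger0_norm.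
  have := lerD nxv (le_trans vp (ler_wpM2l C0 (lerD vz sq))).
  by move=> /le_trans; apply; rewrite /rho1 /rho2 /D; lra.
have M0 t : 0 <= rho1 + rho2 t by rewrite addr_ge0.
apply/lee_addgt0Pr => d d0.
set M := rho1 + rho2 (enorm x) + 1.
have M1 : 0 < M by have := M0 (enorm x); rewrite /M; lra.
(* At [e' = e + eta ^+ 2] the root grows by at most [eta], and [eta ^+ 2 <= eta], so the total
   excess is below [M * eta <= d]. *)
pose eta := Num.min 1 (d / M).
have eta0 : 0 < eta by rewrite lt_min ltr01 divr_gt0.
have eta1 : eta <= 1 by rewrite ge_min lexx.
have etad : M * eta <= d.
  by rewrite mulrC -ler_pdivlMr// ge_min lexx orbT.
apply: (le_trans (step (e + eta ^+ 2) _)); first by rewrite ltrDl exprn_gt0.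
rewrite -EFinD lee_fin.
have e2 : eta ^+ 2 <= eta by rewrite expr2 ger_pMl.
have se : Num.sqrt (e + eta ^+ 2) <= Num.sqrt e + eta.
  rewrite (le_trans (sqrtrD_le _ _)) ?sqr_ge0//.
  by rewrite sqrtr_sqr ger0_norm// ltW.
have := ler_wpM2l (rho20 (enorm x)) se; have := ler_wpM2l rho10 e2.
by move: etad; rewrite /M; nra.
Qed.

End residual_of_bound.

(** * Hausdorff-null rays *)

Section hausdorff_null.
Context {R : realType}.

(** This is (1 - y)^(-p) = exp (- p ln (1 - y)) >= 1 + p y, multiplied by y^p. At y = 1 / (k + 1)
    the right-hand side is k^(-p) - (k + 1)^(-p), which telescopes. *)
Lemma powR_telescope (p y : R) : 0 < p -> 0 < y < 1 ->
  p * y `^ (p + 1) <= (y / (1 - y)) `^ p - y `^ p.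
Proof.
move=> p0 /andP[y0 y1].
have y1' : 0 < 1 - y by lra.
have -> : y `^ (p + 1) = y `^ p * y.
  by rewrite powRD ?powRr1 ?ltW// (gt_eqF y0) implybT.
rewrite powRM ?invr_ge0 ?(ltW y0) ?(ltW y1')//.
have -> : (1 - y)^-1 = expR (- ln (1 - y)) by rewrite expRN lnK.
rewrite -expRM.
have l : ln (1 - y) <= - y by apply: le_ln1Dx; lra.
have e := expR_ge1Dx (- ln (1 - y) * p).
have yp : 1 + p * y <= expR (- ln (1 - y) * p).
  by move: (ler_wpM2l (ltW p0) l) e; lra.
by have := ler_wpM2l (powR_ge0 y p) yp; lra.
Qed.

Lemma pseries_le (s : R) n : 1 < s ->
  \sum_(0 <= j < n) (j.+1%:R^-1 `^ s) <= 1 + (s - 1)^-1.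
Proof.
move=> s1; have [p sE] : exists p, s = p + 1 by exists (s - 1); rewrite subrK.
rewrite {}sE addrK in s1 *; have p0 : 0 < p by lra.
have pV : 0 < p^-1 by rewrite invr_gt0.
have [-> |] := eqVneq n 0%N; first by rewrite big_nil addr_ge0// ltW.
case: n => // n _.
(* Keeping the telescoped remainder on the right makes the bound inductive. *)
suff : \sum_(0 <= j < n.+1) (j.+1%:R^-1 `^ (p + 1)) <=
    1 + p^-1 - p^-1 * n.+1%:R^-1 `^ p.
  by have := mulr_ge0 (ltW pV) (powR_ge0 n.+1%:R^-1 p); lra.
elim: n => [|n ih].
  by rewrite big_nat1 !invr1 !powR1; lra.
rewrite big_nat_recr//=.
have n2 : 0 < (n.+2%:R^-1 : R) < 1.
  by rewrite invr_gt0 invf_lt1 ?ltr1n ?ltr0n.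
have := powR_telescope p0 n2.
have -> : n.+2%:R^-1 / (1 - n.+2%:R^-1) = n.+1%:R^-1 :> R.
  have m0 : 0 < n.+1%:R :> R by rewrite ltr0n.
  rewrite -[n.+2]addn1 natrD; move: (n.+1%:R : R) m0 => m m0; field.
  by rewrite !gt_eqF// ltr_wpDl// ltW.
move=> /(ler_wpM2l (ltW pV)); rewrite mulKf ?gt_eqF//.
by rewrite mulrBr; lra.
Qed.

Context {n : nat}.
Implicit Types (A B : set 'rV[R]_n) (C : nat -> set 'rV[R]_n).

(** A sufficient condition for being H^s-null that passes to finite unions; bounding partial sums
    leaves only finite sums to handle. *)
Definition finely_coverable (s : R) A := forall d e : R, 0 < d -> 0 < e ->
  exists C, [/\ A `<=` \bigcup_j C j, forall j, (diam (C j) <= d%:E)%E &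
    forall k, (\sum_(0 <= j < k) diam (C j) `^ s <= e%:E)%E].

Lemma finely_coverable_null s A :
  finely_coverable s A -> hausdorff_measure s A = 0%E.
Proof.
move=> cA; apply/eqP; rewrite eq_le; apply/andP; split; last first.
  apply: (@le_trans _ _ (ereal_inf
      [set (\sum_(0 <= j <oo) diam (C j) `^ s)%E |
        C in [set C : nat -> set 'rV[R]_n |
          A `<=` \bigcup_j C j /\ forall j, (diam (C j) <= 1%:E)%E]])).
    apply/le_ereal_inf_tmp => _ [C _ <-].
    by apply: nneseries_ge0 => j _ _; exact: poweR_ge0.
  by apply: ereal_sup_ubound; exists 1 => //=; exact: ltr01.
apply: ge_ereal_sup => _ [d /= d0 <-].
apply/lee_addgt0Pr => e e0; rewrite add0e.
have [C [AC Cd Ce]] := cA d e d0 e0.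
apply: ge_ereal_inf; exists (\sum_(0 <= j <oo) diam (C j) `^ s)%E.
  by exists C.
apply: lime_le.
  by apply: is_cvg_nneseries => j _ _; exact: poweR_ge0.
by apply: nearW => k; exact: Ce.
Qed.

Lemma finely_coverable0 s : 0 < s -> finely_coverable s set0.
Proof.
move=> s0 d e d0 e0; exists (fun=> set0).
have dm0 : diam (set0 : set 'rV[R]_n) = 0%E.
  rewrite /diam (_ : _ `|` _ = [set 0%E]) ?ereal_sup1//.
  by apply/seteqP; split => [_ [//|[? []]]//|]; left.
split => [//|j|k]; first by rewrite dm0 lee_fin ltW.
by rewrite big1 ?lee_fin ?ltW// => j _; rewrite dm0 poweR_EFin powR0// gt_eqF.
Qed.

(** The two covers, each with half of [e], are interleaved on even and odd indices. *)
Lemma finely_coverableU s A B : finely_coverable s A ->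
  finely_coverable s B -> finely_coverable s (A `|` B).
Proof.
move=> cA cB d e d0 e0.
have e20 : 0 < e / 2 by lra.
have [C [AC Cd Ce]] := cA d (e / 2) d0 e20.
have [D [BD Dd De]] := cB d (e / 2) d0 e20.
exists (fun j => if odd j then D j./2 else C j./2); split.
- move=> x [/AC[j _ Cx]|/BD[j _ Dx]].
    by exists j.*2 => //; rewrite odd_double doubleK.
  by exists j.*2.+1 => //=; rewrite odd_double/= uphalf_double.
- by move=> j; case: ifP.
move=> k.
have double m (u : nat -> \bar R) : (forall j, 0 <= u j)%E ->
    (\sum_(0 <= j < m.*2) u j =
     \sum_(0 <= j < m) u j.*2 + \sum_(0 <= j < m) u j.*2.+1)%E.
  move=> u0; elim: m => [|m ih]; first by rewrite !big_nil adde0.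
  by rewrite doubleS !big_nat_recr//= ih -!addeA; congr (_ + _)%E; rewrite addeCA.
(* Padding to an even length only adds nonnegative terms, after which the sum splits by parity. *)
apply: (@le_trans _ _ (\sum_(0 <= j < k.*2)
    diam (if odd j then D j./2 else C j./2) `^ s)%E).
  rewrite (@big_cat_nat _ _ _ k 0 k.*2)//= -?addnn ?leq_addr//.
  by rewrite leeDl// sume_ge0// => j _; exact: poweR_ge0.
rewrite double; last by move=> j; exact: poweR_ge0.
rewrite [e]splitr EFinD leeD//.
  by under eq_bigr do rewrite odd_double doubleK.
by under eq_bigr do rewrite /= odd_double/= uphalf_double.
Qed.

Lemma finely_coverable_bigcup s (T : choiceType) (r : seq T) (A : T -> set 'rV[R]_n) :
  0 < s -> (forall i, finely_coverable s (A i)) ->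
  finely_coverable s (\bigcup_(i in [set` r]) A i).
Proof.
move=> s0 cA; rewrite bigcup_seq; elim: r => [|i r ih].
  by rewrite big_nil; exact: finely_coverable0.
by rewrite big_cons; exact: finely_coverableU.
Qed.

Lemma enormZ (a : R) (w : 'rV[R]_n) : enorm (a *: w) = `|a| * enorm w.
Proof.
rewrite /enorm /inner; under eq_bigr do rewrite !mxE mulrACA -expr2.
by rewrite -mulr_sumr sqrtrM ?sqr_ge0// sqrtr_sqr.
Qed.

(* The ray is cut into pieces of lengths proportional to the harmonic series,
   which diverges while its [s]-th powers have a bounded sum. *)
Lemma finely_coverable_ray s A w : 1 < s ->
  (forall x, A x -> exists2 l : R, 0 <= l & x = l *: w) -> finely_coverable s A.
Proof.
move=> s1 Aw d e d0 e0.
pose M : R := 1 + (s - 1)^-1.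
have M0 : 0 < M by rewrite /M addr_gt0// invr_gt0; lra.
(* The three bounds serve the diameters, the estimate (dl x)^s <= dl x^s, and the total sum, [M]
   being the bound of [pseries_le]. *)
pose dl := Num.min (Num.min d 1) (e / M).
have dl0 : 0 < dl by rewrite !lt_min d0 ltr01 divr_gt0.
have dld : dl <= d by rewrite !ge_min lexx.
have dl1 : dl <= 1 by rewrite !ge_min lexx orbT.
have dle : dl * M <= e by rewrite -ler_pdivlMr// ge_min lexx orbT.
have L0 : 0 <= enorm w by exact: sqrtr_ge0.
(* The summand 1 keeps the denominator positive when [w = 0]. *)
pose eta : R := dl / (enorm w + 1).
have eta0 : 0 < eta by rewrite divr_gt0// ltr_wpDl.
have etaL : eta * enorm w <= dl.
  by rewrite /eta mulrAC ler_pdivrMr ?ltr_wpDl// ler_wpM2l ?ltW// ltrDl ltr01.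
pose H k : R := \sum_(0 <= j < k) j.+1%:R^-1.
have HS k : H k.+1 = H k + k.+1%:R^-1 by rewrite /H big_nat_recr.
pose C j := [set l *: w | l in [set l : R | eta * H j <= l <= eta * H j.+1]].
have dC j : (diam (C j) <= (dl * j.+1%:R^-1)%:E)%E.
  have dj0 : 0 <= dl * j.+1%:R^-1 by rewrite mulr_ge0 ?invr_ge0// ltW.
  apply: ge_ereal_sup => _ [->|[_ [l /andP[l1 l2] <-] [_ [m /andP[m1 m2] <-] <-]]].
    by rewrite lee_fin.
  rewrite -scalerBl enormZ lee_fin (@le_trans _ _ (eta * j.+1%:R^-1 * enorm w))//.
    rewrite ler_wpM2r//; move: l2 m2; rewrite HS; move: l1 m1.
    move: (H j) (j.+1%:R^-1 : R) => h v.
    by rewrite mulrDr ler_norml => l1 m1 l2 m2; apply/andP; split; lra.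
  by rewrite mulrAC ler_wpM2r ?invr_ge0.
have diam0 j : (0 <= diam (C j))%E.
  by apply: ereal_sup_ubound; left.
exists C; split.
- move=> x /Aw[l l0 ->].
  have [k Hk] : exists k, l < eta * H k.
    apply: contrapT => Hl; apply: (@dvg_harmonic R).
    apply: nondecreasing_is_cvgn.
      apply/nondecreasing_seqP => k; rewrite /series/= big_nat_recr//= lerDl.
      exact: harmonic_ge0.
    exists (l / eta) => _ [k _ <-].
    rewrite ler_pdivlMr// mulrC leNgt; apply/negP => lk.
    by apply: Hl; exists k.
  (* The point lies in the piece ending at the first partial sum beyond [l]; that index is positive
     because [H 0 = 0]. *)
  have exk : exists k, l < eta * H k by exists k.
  case: (ex_minnP exk) => -[|m] lm minm.
    by move: lm; rewrite /H big_nil mulr0 ltNge l0.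
  exists m => //; exists l => //=; rewrite (ltW lm) andbT leNgt.
  by apply/negP => /minm; rewrite ltnn.
- move=> j; apply: (le_trans (dC j)); rewrite lee_fin (le_trans _ dld)//.
  by rewrite ger_pMr// invf_le1 ?ltr0n// ler1n.
move=> k.
apply: (@le_trans _ _ (\sum_(0 <= j < k) (dl * j.+1%:R^-1 `^ s)%:E)%E).
  apply: lee_sum => j _.
  apply: (@le_trans _ _ ((dl * j.+1%:R^-1) `^ s)%:E).
    rewrite -poweR_EFin; apply: gt0_ler_poweR => //; first lra.
      by rewrite in_itv/= diam0 leey.
    by rewrite in_itv/= lee_fin leey andbT mulr_ge0 ?invr_ge0// ltW.
  rewrite lee_fin ge1r_powRZ ?dl0 ?invr_ge0//; lra.
rewrite sumEFin lee_fin -mulr_sumr (le_trans _ dle)// ler_wpM2l ?(ltW dl0)//.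
exact: pseries_le.
Qed.

End hausdorff_null.

(** * Convex functions of one variable *)

Section convex_function.
Context {R : realType} {f : R -> \bar R}.
Context (f_ge0 : forall x, (0 <= f x)%E) (f_convex : econvex f).
Local Notation F := (fine \o f : R -> R).
Local Notation dom := (effdom f).

Lemma effdomE y : dom y -> f y = (F y)%:E.
Proof.
rewrite /effdom/= => fy; rewrite fineK// ge0_fin_numE//.
Qed.

Lemma effdom_le y r : (f y <= r%:E)%E -> dom y /\ F y <= r.
Proof.
move=> fr; have dy : dom y by rewrite /effdom/= (le_lt_trans fr)// ltry.
by split => //; rewrite -lee_fin -effdomE.
Qed.

Lemma fine_ge0 y : 0 <= F y.
Proof. exact: fine_ge0. Qed.

Lemma effdom_conv x y t : dom x -> dom y -> 0 <= t <= 1 ->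
  dom (t * x + (1 - t) * y) /\
  F (t * x + (1 - t) * y) <= t * F x + (1 - t) * F y.
Proof.
move=> dx dy /andP[]; rewrite le_eqVlt => /predU1P[<- _|t0].
  by rewrite subr0 !mul1r !mul0r !add0r.
rewrite le_eqVlt => /predU1P[->|t1].
  by rewrite subrr !mul1r !mul0r !addr0.
by apply: effdom_le; rewrite EFinD !EFinM -!effdomE//; exact: f_convex.
Qed.

Lemma chord_le x d t : dom x -> dom (x + d) -> 0 <= t <= 1 ->
  dom (x + t * d) /\ F (x + t * d) - F x <= t * (F (x + d) - F x).
Proof.
move=> dx dd t01; have := effdom_conv dd dx t01.
have -> : t * (x + d) + (1 - t) * x = x + t * d by ring.
by move=> [? H]; split => //; move: H; lra.
Qed.

Lemma effdom_between p q y : dom p -> dom q -> p < y < q -> (dom)° y.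
Proof.
move=> dp dq /andP[py yq].
have : nbhs y `]p, q[%classic by apply: near_in_itvoo; rewrite in_itv/= py.
apply: filterS => x /=; rewrite in_itv/= => /andP[px xq].
have pq : 0 < q - p by lra.
have := @chord_le p (q - p) ((x - p) / (q - p)) dp.
rewrite divfK ?gt_eqF// !subrKC => H; apply: (H dq _).1.
by rewrite divr_ge0 ?ler_pdivrMr//= ?mul1r; lra.
Qed.

Lemma interior_effdom y : (dom)° y -> dom y.
Proof. exact: interior_subset. Qed.

(** If the tangent exceeded [F y], the difference quotients of [F] towards [y], which lie below the
    slope of the chord by convexity, could not converge to the derivative. *)
Lemma tangent_le x y : (dom)° x -> derivable F x 1 -> dom y ->
  F x + fderiv f x * (y - x) <= F y.
Proof.
move=> ix dFx dy; have dx := interior_effdom ix.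
rewrite leNgt; apply/negP => lt.
set d := y - x in lt.
have d0 : d != 0.
  apply: contraTneq lt => d0.
  by rewrite d0 mulr0 addr0 -leNgt -(subrK x y) -/d d0 add0r.
have nd0 : 0 < `|d| by rewrite normr_gt0.
pose eps := (F x + fderiv f x * d - F y) / `|d|.
have eps0 : 0 < eps by rewrite divr_gt0// subr_gt0.
have cF : h^-1 *: (F (h *: 1 + x) - F x) @[h --> 0^'] --> fderiv f x.
  by rewrite /fderiv derive1E; exact: dFx.
have : \forall h \near 0^',
    `|fderiv f x - h^-1 *: (F (h *: 1 + x) - F x)| < eps.
  by move/cvgrPdist_lt : cF; apply.
rewrite near_withinE => /nbhs_ballP[eta /= eta0 near0].
(* The point [x + t * d] stays on the segment from [x] to [y], and the factor 2 puts it strictly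
   within [eta] of [x]. *)
pose t := Num.min 1 (eta / (2 * `|d|)).
have t0 : 0 < t by rewrite lt_min ltr01 divr_gt0// mulr_gt0.
have t1 : t <= 1 by rewrite ge_min lexx.
have td : t * `|d| < eta.
  rewrite (@le_lt_trans _ _ (eta / 2))//; last by lra.
  by rewrite -ler_pdivlMr// -mulrA -invfM ge_min lexx orbT.
have td0 : t * d != 0 by rewrite mulf_neq0// gt_eqF.
have := near0 (t * d); rewrite /ball/= sub0r normrN normrM (gtr0_norm t0).
rewrite [(t * d) *: 1]mulr1 [t * d + x]addrC => /(_ td td0) near_td.
have dxd : dom (x + d) by rewrite /d subrKC.
have t01 : 0 <= t <= 1 by rewrite (ltW t0).
have := (chord_le dx dxd t01).2; rewrite [x + d]subrKC.
move: near_td; rewrite -![fine (f _)]/(F _); set G := F (x + t * d) - F x.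
have -> : fderiv f x - (t * d)^-1 *: G = (fderiv f x * (t * d) - G) / (t * d).
  by rewrite mulrBl mulfK// [_ / _]mulrC.
rewrite normrM normfV ltr_pdivrMr ?normr_gt0//.
move=> /(le_lt_trans (ler_norm _)); rewrite normrM (gtr0_norm t0).
have -> : eps * (t * `|d|) = t * (F x + fderiv f x * d - F y).
  by rewrite /eps mulrCA divfK ?gt_eqF.
by move=> near_td chord; lra.
Qed.

Lemma fderiv_monotone x y : (dom)° x -> (dom)° y ->
  derivable F x 1 -> derivable F y 1 ->
  0 <= (fderiv f y - fderiv f x) * (y - x).
Proof.
move=> ix iy dFx dFy.
have := tangent_le ix dFx (interior_effdom iy).
have := tangent_le iy dFy (interior_effdom ix).
lra.
Qed.

(** By convexity the difference quotients from [y0] are nondecreasing, so their limit is their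
    supremum and bounding it means bounding each of them. *)
Lemma recession_leP x r : dom !=set0 -> let y0 := xget 0 dom in
  (recession f x <= r%:E)%E <->
  forall u, 1 <= u -> dom (y0 + u * x) /\ F (y0 + u * x) <= F y0 + u * r.
Proof.
move=> dom0 y0.
have dy0 : dom y0 by apply: xgetPex; exact: dom0.
pose g u := ((f (y0 + u * x)%R - f y0) * (u^-1)%:E)%E.
have g_fin u : dom (y0 + u * x) -> g u = ((F (y0 + u * x) - F y0) / u)%:E.
  by move=> du; rewrite /g (effdomE du) (effdomE dy0).
have g_le u c : 0 < u -> (g u <= c%:E)%E <->
    dom (y0 + u * x) /\ F (y0 + u * x) <= F y0 + u * c.
  move=> u0; split => [guc|[du Fu]].
    have du : dom (y0 + u * x).
      rewrite /effdom/= ltey; apply/eqP => fu.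
      move: guc; rewrite /g fu (effdomE dy0) /= addye//.
      by rewrite gt0_mulye ?lte_fin ?invr_gt0.
    split => //; move: guc; rewrite g_fin// lee_fin ler_pdivrMr//; lra.
  by rewrite g_fin// lee_fin ler_pdivrMr//; move: Fu; lra.
have g_mono a b : 1 <= a -> a <= b -> (g a <= g b)%E.
  move=> a1 ab; have [db|] := pselect (dom (y0 + b * x)); last first.
    move=> /negP; rewrite /effdom/= -leNgt leye_eq => /eqP fb.
    rewrite {2}/g fb (effdomE dy0) /= addye// gt0_mulye ?leey// lte_fin invr_gt0; lra.
  have b0 : 0 < b by lra.
  have a0 : 0 < a by lra.
  have ab01 : 0 <= a / b <= 1 by rewrite divr_ge0 ?ler_pdivrMr ?mul1r//= ltW.
  have [] := chord_le dy0 db ab01.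
  rewrite mulrA divfK ?gt_eqF// => da Fa.
  rewrite !g_fin// lee_fin ler_pdivrMr// (le_trans Fa)//.
  by rewrite le_eqVlt; apply/orP; left; apply/eqP; field; rewrite gt_eqF.
(* Freezing [g] below 1 makes it monotone on the whole line without changing its limit at
   infinity. *)
pose G u := g (Num.max u 1).
have G_mono : {homo G : u v / u <= v >-> (u <= v)%E}.
  move=> u v uv; apply: g_mono; first by rewrite le_max lexx orbT.
  by rewrite ge_max !le_max uv lexx !orbT.
have rE : recession f x = ereal_sup (range G).
  apply: cvg_lim; first exact: ereal_hausdorff.
  apply: cvg_trans (nondecreasing_cvge G_mono).
  apply: near_eq_cvg; near=> u.
  rewrite /G max_l//; near: u; exact: nbhs_pinfty_ge.
rewrite rE; split => [sr u u1|H].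
  apply/g_le; first by lra.
  apply: le_trans sr; apply: ereal_sup_ubound; exists u => //.
  by rewrite /G max_l.
apply: ge_ereal_sup => _ [u _ <-].
have u1 : 1 <= Num.max u 1 by rewrite le_max lexx orbT.
by apply/g_le; [lra|exact: H].
Unshelve. all: by end_near. Qed.

End convex_function.

(** * The epigraph cone and its dual *)

Section epigraph_cone.
Context {R : realType} {f : R -> \bar R}.
Context (f_ge0 : forall x, (0 <= f x)%E) (f_convex : econvex f).
Context (dom0 : effdom f !=set0).
Local Notation F := (fine \o f : R -> R).
Local Notation dom := (effdom f).
Local Notation K := (epi_perspective f).
Implicit Types (v z : 'rV[R]_3).

Lemma epi_perspectiveP v : K v <->
  (0 < v 0 1 /\ dom (v 0 0 / v 0 1) /\ v 0 1 * F (v 0 0 / v 0 1) <= v 0 2) \/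
  (v 0 1 = 0 /\ (recession f (v 0 0)%R <= (v 0 2)%R%:E)%E).
Proof.
rewrite /epi_perspective/= /perspective.
have [t0|t0|t0] := ltgtP (v 0 1) 0.
- by split=> [|[[]|[t00]]]//; rewrite t00 ltxx in t0.
- split=> [le|[[_ [dx le]]|[t00]]]; last by rewrite t00 ltxx in t0.
    left; split => //.
    have dx : dom (v 0 0 / v 0 1).
      rewrite /effdom/= ltey; apply/eqP => fx; move: le.
      by rewrite fx gt0_muley ?lte_fin// leye_eq.
    by split => //; move: le; rewrite (effdomE f_ge0 dx).
  by rewrite (effdomE f_ge0 dx) -EFinM lee_fin.
- by rewrite t0; split=> [le|[[]|[]]//]; right.
Qed.

(* The restriction of [inner z] to the section [(y, 1, f y)] of the cone. *)
Definition slack z y : R := z 0 0 * y + z 0 1 + z 0 2 * F y.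

Definition dual_slack z := 0 <= z 0 2 /\ forall y, dom y -> 0 <= slack z y.

Lemma epi_axis r : 0 <= r -> K (vec3 0 0 r).
Proof.
move=> r0; apply/epi_perspectiveP; right; rewrite !vec3E; split => //.
apply/(recession_leP f_ge0 f_convex _ _ dom0) => u u1; rewrite mulr0 addr0.
split; first by apply: xgetPex; exact: dom0.
by rewrite lerDl mulr_ge0//; lra.
Qed.

Lemma epi_scale t y : 0 <= t -> dom y -> K (vec3 (t * y) t (t * F y)).
Proof.
rewrite le_eqVlt => /predU1P[<- _|t0 dy].
  by rewrite !mul0r; exact: epi_axis.
apply/epi_perspectiveP; left; rewrite !vec3E; split => //.
by rewrite mulrAC divff ?gt_eqF// mul1r.
Qed.

Lemma epi_slack v z : 0 < v 0 1 -> K v -> 0 <= z 0 2 ->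
  v 0 1 * slack z (v 0 0 / v 0 1) <= inner v z.
Proof.
move=> t0 /epi_perspectiveP[[_ [_ le]] c0|[t00]]; last by rewrite t00 ltxx in t0.
rewrite inner3 /slack !mulrDr [v 0 1 * (z 0 0 * _)]mulrCA.
rewrite [v 0 1 * (_ / _)]mulrCA divff ?gt_eqF// mulr1.
have := ler_wpM2r c0 le; lra.
Qed.

(** Necessity comes from testing on the vertical axis and on the points [(y, 1, F y)]. Conversely, a
    recession direction pairing negatively with [z] would drive the slack below 0 far along it. *)
Lemma dual_coneP z : dual_cone K z <-> dual_slack z.
Proof.
split=> [Kz|[c0 Dz] v Kv].
  split.
    by have := Kz _ (epi_axis ler01); rewrite inner3 !vec3E; lra.
  move=> y dy; have := Kz _ (epi_scale ler01 dy).
  by rewrite inner3 !vec3E /slack; lra.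
move: (Kv) => /epi_perspectiveP[[t0 [dx _]]|[t0]].
  apply: le_trans (epi_slack t0 Kv c0).
  by rewrite mulr_ge0 ?Dz// ltW.
move=> /(recession_leP f_ge0 f_convex _ _ dom0); set y0 := xget _ _ => rec.
have dy0 : dom y0 by apply: xgetPex; exact: dom0.
rewrite inner3 t0 mul0r addr0.
set L := _ + _; rewrite leNgt; apply/negP => L0.
(* The slack at [y0 + u * x] is at most [slack z y0 + u * L], which for this [u] equals [L < 0]. *)
pose u := 1 + slack z y0 / - L.
have s0 := Dz _ dy0.
have u1 : 1 <= u by rewrite lerDl divr_ge0// oppr_ge0 ltW.
have [du Fu] := rec u u1.
have := Dz _ du; rewrite /slack.
have := ler_wpM2l c0 Fu.
have : u * - L = - L + slack z y0.
  by rewrite /u mulrDl mul1r divfK// oppr_eq0 lt_eqF.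
move: u {u1 du} Fu => u Fu; move: L0; rewrite /slack /L /=; lra.
Qed.

(** The dual cone is an intersection of closed half-spaces, hence contains its boundary. *)
Lemma dual_slack_closed z : closure (dual_cone K) z -> dual_slack z.
Proof.
move=> clz.
suff pos x t r : K (vec3 x t r) -> 0 <= x * z 0 0 + t * z 0 1 + r * z 0 2.
  apply/dual_coneP => v Kv; rewrite inner3; apply: pos.
  by rewrite (_ : vec3 _ _ _ = v)//; apply: eq_vec3; rewrite vec3E.
move=> Kv; apply/ler_addgt0Pr => e e0.
pose M := norm1 (vec3 x t r) + 1.
have M0 : 0 < M by have := norm1_ge0 (vec3 x t r); rewrite /M; lra.
have [z' [/(_ _ Kv) + bz']] := clz _ (nbhsx_ballx z _ (divr_gt0 e0 M0)).
have {}bz' i : `|z 0 i - z' 0 i| < e / M := bz'.2 0 i.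
rewrite inner3 !vec3E => pos.
have le (a b b' : R) : `|b - b'| < e / M -> a * b' <= a * b + `|a| * (e / M).
  move=> bb'; rewrite -lerBlDl -mulrBr (le_trans (ler_norm _))// normrM.
  by rewrite ler_wpM2l// ltW// distrC.
have := le x _ _ (bz' 0); have := le t _ _ (bz' 1); have := le r _ _ (bz' 2).
have : (`|x| + `|t| + `|r|) * (e / M) <= e.
  have -> : `|x| + `|t| + `|r| = M - 1 by rewrite /M /norm1 !vec3E addrK.
  by rewrite mulrA ler_pdivrMr// mulrC ler_wpM2l ?(ltW e0)//; lra.
lra.
Qed.

(** Moving each coordinate of [z] by at most [e] lowers the slack at [y] by at most
    [e * (|y| + 1 + F y)]. *)
Lemma dual_slack_interior z e : 0 < e -> e <= z 0 2 ->
  (forall y, dom y -> e * (`|y| + 1 + F y) <= slack z y) ->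
  (dual_cone K)° z.
Proof.
move=> e0 ec le; apply/nbhs_ballP; exists e => // z' bz'.
have {}bz' i : `|z 0 i - z' 0 i| < e := bz'.2 0 i.
apply/dual_coneP; split.
  by have := ler_norm (z 0 2 - z' 0 2); have := bz' 2; lra.
move=> y dy; have := le y dy; rewrite /slack.
have b0 : z 0 0 * y - z' 0 0 * y <= e * `|y|.
  rewrite -mulrBl (le_trans (ler_norm _))// normrM ler_wpM2r//.
  by rewrite ltW.
have b1 := le_lt_trans (ler_norm _) (bz' 1).
have b2 : (z 0 2 - z' 0 2) * F y <= e * F y.
  by rewrite ler_wpM2r ?fine_ge0// (le_trans (ler_norm _))// ltW.
lra.
Qed.

End epigraph_cone.

Arguments slack {R} f z y.
Arguments dual_slack {R} f z.

(** * Slope of the slack, critical points and unbounded domains *)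

Section slack_calculus.
Context {R : realType} {f : R -> \bar R}.
Context (f_ge0 : forall x, (0 <= f x)%E) (f_convex : econvex f).
Context (f_smooth : essentially_smooth f).
Local Notation F := (fine \o f : R -> R).
Local Notation dom := (effdom f).
Local Notation h z := (slack f z).
Implicit Types (z : 'rV[R]_3) (x y t d : R).

Let dF x : (dom)° x -> derivable F x 1.
Proof. by case: f_smooth => _ dF _; exact: dF. Qed.

Definition dslack z x : R := z 0 0 + z 0 2 * fderiv f x.

Lemma slack_tangent_le z x y : 0 <= z 0 2 -> (dom)° x -> dom y ->
  h z x + dslack z x * (y - x) <= h z y.
Proof.
move=> c0 ix dy; have := ler_wpM2l c0 (tangent_le f_ge0 f_convex ix (dF ix) dy).
by rewrite /slack /dslack; lra.
Qed.

Lemma slack_chord_le z x d t : 0 <= z 0 2 -> dom x -> dom (x + d) ->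
  0 <= t <= 1 -> dom (x + t * d) /\
  h z (x + t * d) - h z x <=
    t * (h z (x + d) - h z x).
Proof.
move=> c0 dx dd t01; have [dt Ft] := chord_le f_ge0 f_convex dx dd t01.
split => //; have := ler_wpM2l c0 Ft.
by rewrite /slack; lra.
Qed.

(** The sign [s] treats the two directions of the line at once, here and below. *)
Lemma effdom_ray p s u u' : s = 1 \/ s = -1 -> dom p -> dom (p + s * u') ->
  0 < u < u' -> (dom)° (p + s * u).
Proof.
move=> [] -> dp dq /andP[u0 uu'].
  by apply: (effdom_between f_ge0 f_convex dp dq); lra.
by apply: (effdom_between f_ge0 f_convex dq dp); lra.
Qed.

Lemma is_derive_slack z x : (dom)° x -> is_derive x 1 (h z) (dslack z x).
Proof.
move=> ix; have dFx : is_derive x 1 F (fderiv f x).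
  by rewrite /fderiv derive1E; exact/derivableP/dF.
rewrite (_ : h z = (fun y => z 0 0 * y + z 0 1 + z 0 2 * F y))//.
rewrite /dslack -[z 0 0 in X in is_derive _ _ _ X]mulr1.
apply: is_deriveD => /=.
  by rewrite -[X in is_derive _ _ _ X]addr0; apply: is_deriveD.
Qed.

(** Darboux's argument: the slack attains a minimum on a segment around [x1] and [x2], and the
    tangents at these points make both endpoints too high to be minimal. *)
Lemma slack_minimizer z x1 x2 : 0 < z 0 2 -> (dom)° x1 -> (dom)° x2 ->
  dslack z x1 < 0 -> 0 < dslack z x2 -> exists2 x, (dom)° x & dslack z x = 0.
Proof.
move=> c0 i1 i2 h1 h2.
have c0' := ltW c0.
have x12 : x1 < x2.
  have := fderiv_monotone f_ge0 f_convex i1 i2 (dF i1) (dF i2).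
  move: h1 h2; rewrite /dslack => h1 h2 mono.
  rewrite ltNge; apply/negP => x21.
  have F12 : fderiv f x1 < fderiv f x2 by rewrite -(ltr_pM2l c0); lra.
  have x12 : 0 <= x2 - x1.
    by rewrite -(pmulr_rge0 _ (_ : 0 < fderiv f x2 - fderiv f x1)) ?subr_gt0.
  have x12' : x2 = x1 by lra.
  by move: F12; rewrite x12' ltxx.
have [p dp px1] : exists2 p, dom p & p < x1.
  have /nbhs_ballP[e /= e0 be] := i1.
  exists (x1 - e / 2); last by lra.
  by apply: be; rewrite /ball/= opprB addrC subrK ger0_norm; lra.
have [q dq qx2] : exists2 q, dom q & x2 < q.
  have /nbhs_ballP[e /= e0 be] := i2.
  exists (x2 + e / 2); last by lra.
  by apply: be; rewrite /ball/= opprD addNKr normrN ger0_norm; lra.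
have pq : p < q by lra.
have ipq y : p < y < q -> (dom)° y by exact: effdom_between.
(* Midpoints are taken so that the whole closed segment lies in the interior of the domain. *)
pose p' := (p + x1) / 2; pose q' := (x2 + q) / 2.
have p'q' : p' <= q' by rewrite /p' /q'; lra.
have ipq' y : p' <= y <= q' -> (dom)° y.
  by move=> /andP[]; rewrite /p' /q' => py yq; apply: ipq; lra.
have [c cpq cmin] : exists2 c, c \in `[p', q'] &
    forall t, t \in `[p', q'] -> h z c <= h z t.
  apply: EVT_min => //; apply: derivable_within_continuous => y.
  by rewrite in_itv/= => /ipq' iy; have [] := is_derive_slack z iy.
have dp' : (dom)° p' by apply: ipq'; rewrite lexx.
have dq' : (dom)° q' by apply: ipq'; rewrite lexx andbT.
have hp : h z x1 < h z p'.
  apply: lt_le_trans (slack_tangent_le c0' i1 (interior_effdom dp')).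
  by rewrite ltrDl nmulr_rgt0// /p'; lra.
have hq : h z x2 < h z q'.
  apply: lt_le_trans (slack_tangent_le c0' i2 (interior_effdom dq')).
  by rewrite ltrDl mulr_gt0// /q'; lra.
have c1 := cmin x1; have c2 := cmin x2.
rewrite !in_itv/= in cpq c1 c2.
have {}c1 : h z c <= h z x1 by apply: c1; rewrite /p' /q'; lra.
have {}c2 : h z c <= h z x2 by apply: c2; rewrite /p' /q'; lra.
have cp : c != p' by apply: contraTneq hp => <-; rewrite -leNgt.
have cq : c != q' by apply: contraTneq hq => <-; rewrite -leNgt.
have coo : c \in `]p', q'[.
  by rewrite in_itv/= !lt_neqAle eq_sym cp cq/= andbC [_ && _]andbC.
exists c; first exact: ipq'.
have [_ <-] := is_derive_slack z (ipq' _ cpq).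
have [] := @derive1_at_min _ (h z) _ _ c p'q' _ coo _ => //.
- move=> t; rewrite in_itv/= => /andP[pt tq].
  by have [] := is_derive_slack z (ipq' t _) => //; rewrite !ltW.
- move=> t; rewrite in_itv/= => /andP[pt tq]; apply: cmin.
  by rewrite in_itv/= !ltW.
Qed.

(** At a finite end of the domain in direction [s] the derivative would have to blow up. But
    [s * f'] is bounded above by the sign condition and, towards that end, below by monotonicity. *)
Lemma effdom_unbounded z s : 0 < z 0 2 -> s = 1 \/ s = -1 ->
  (forall y, (dom)° y -> s * dslack z y < 0) ->
  forall y u, dom y -> 0 < u -> (dom)° (y + s * u).
Proof.
move=> c0 s1 hneg.
have [[i0 ii0] _ blowup] := f_smooth.
have di0 := interior_effdom ii0.
have ss : s * s = 1 by case: s1 => ->; lra.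
suff unb : forall M, exists2 u, M < u & dom (i0 + s * u).
  (* A domain point beyond [y + s * u], found from [i0], leaves [y + s * u] strictly between it and
     [y]. *)
  move=> y u dy u0.
  have [v Mv dv] := unb (s * (y + s * u - i0)).
  apply: (@effdom_ray y s u (s * (i0 + s * v - y))) => //.
    by rewrite mulrA ss mul1r subrKC.
  rewrite u0/=; move: Mv.
  rewrite !(mulrBr, mulrDr) !mulrA ss !mul1r; lra.
move=> M0; apply: contrapT => bnd.
pose S := [set u | 0 <= u /\ dom (i0 + s * u)].
have S0 : S 0 by split; rewrite ?mulr0 ?addr0.
have ubS : ubound S M0.
  move=> u [_ du]; rewrite leNgt; apply/negP => Mu; apply: bnd; by exists u.
have hsS : has_sup S by split; [exists 0 | exists M0].
pose us := sup S.
have us0 : 0 <= us by apply: ub_le_sup => //; exists M0.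
have below u : 0 <= u -> u < us \/ u = 0 -> (dom)° (i0 + s * u).
  move=> + []; last by move=> _ ->; rewrite mulr0 addr0.
  rewrite le_eqVlt => /predU1P[<- _|u0 uus]; first by rewrite mulr0 addr0.
  have [v [_ dv] uv] := sup_gt (ex_intro _ 0 S0) uus.
  by apply: effdom_ray di0 dv _ => //; rewrite u0.
(* These parameters tend to the endpoint [us], starting at 0 and staying strictly below [us] when
   [us > 0]. *)
pose uk k : R := us - us * k.+1%:R^-1.
have uk0 k : 0 <= uk k.
  by rewrite subr_ge0 ler_piMr// invf_le1 ?ltr0n// ler1n.
have uki k : (dom)° (i0 + s * uk k).
  apply: below => //; move: us0; rewrite le_eqVlt => /predU1P[us00|us0].
    by right; rewrite /uk -us00 mul0r subr0.
  by left; rewrite gtrDl oppr_lt0 mulr_gt0// invr_gt0.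
have ukb : (i0 + s * uk k) @[k --> \oo] --> i0 + s * us.
  apply: cvgD; first exact: cvg_cst.
  apply: cvgM; first exact: cvg_cst.
  rewrite -[us in X in _ --> X]subr0 -[in X in _ --> X](mulr0 us).
  apply: cvgB; first exact: cvg_cst.
  by apply: cvgM; [exact: cvg_cst|exact: cvg_harmonic].
have bdryb : bdry dom (i0 + s * us).
  split.
    move=> A /ukb[n _ An]; exists (i0 + s * uk n); split.
      exact: interior_effdom.
    exact: An (leqnn n).
  move=> /nbhs_ballP[e /= e0 be].
  (* If the endpoint were interior, the domain would continue past it by [e / 2], against the
     supremum. *)
  have : us + e / 2 <= us.
    apply: ub_le_sup; first by exists M0.
    split; first lra.
    apply: be; rewrite /ball/= (_ : _ - _ = - (s * (e / 2))); last by lra.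
    rewrite normrN; have -> : `|s * (e / 2)| = e / 2; last lra.
      by case: s1 => ->; rewrite normrM ?normrN normr1 mul1r ger0_norm//; lra.
  lra.
have := blowup _ _ uki ukb bdryb.
(* [A] dominates both one-sided bounds on [s * f'], whereas blow-up makes [|f'|] reach [A + 1]. *)
pose A := `|fderiv f i0| + `|z 0 0 / z 0 2|.
move/cvgryPge => /(_ (A + 1)) [n _ /(_ n (leqnn n))] /=.
apply/negP; rewrite -ltNge.
suff : `|s * fderiv f (i0 + s * uk n)| <= A.
  rewrite normrM (_ : `|s| = 1) ?mul1r; first by lra.
  by case: s1 => ->; rewrite ?normrN normr1.
have up : s * fderiv f (i0 + s * uk n) <= - (s * (z 0 0 / z 0 2)).
  have := hneg _ (uki n); rewrite /dslack mulrDr => lt0.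
  have e : z 0 2 * (s * (z 0 0 / z 0 2)) = s * z 0 0 by field; rewrite gt_eqF.
  rewrite -(ler_pM2l c0) mulrN e; lra.
have lo : s * fderiv f i0 <= s * fderiv f (i0 + s * uk n).
  have [->|un0] := eqVneq (uk n) 0; first by rewrite mulr0 addr0.
  have un : 0 < uk n by rewrite lt_neqAle eq_sym un0 uk0.
  have := fderiv_monotone f_ge0 f_convex ii0 (uki n) (dF ii0) (dF (uki n)).
  rewrite [_ - i0]addrC addKr mulrA pmulr_lge0//; lra.
have sn x : `|s * x| = `|x|.
  by rewrite normrM (_ : `|s| = 1) ?mul1r//; case: s1 => ->; rewrite ?normrN normr1.
have n1 : - (s * (z 0 0 / z 0 2)) <= `|z 0 0 / z 0 2|.
  by rewrite -[leRHS]sn -normrN ler_norm.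
have n2 : - (s * fderiv f i0) <= `|fderiv f i0|.
  by rewrite -[leRHS]sn -normrN ler_norm.
have n3 := normr_ge0 (fderiv f i0); have n4 := normr_ge0 (z 0 0 / z 0 2).
move: up lo n1 n2 n3 n4; rewrite ler_norml /A.
move: (z 0 0 / z 0 2) (fderiv f i0) (fderiv f _) => k g0 g *.
by apply/andP; split; lra.
Qed.

End slack_calculus.

Arguments dslack {R} f z x.

(** * Residual bounds *)

Section residual_bounds.
Context {R : realType} {f : R -> \bar R}.
Context (f_ge0 : forall x, (0 <= f x)%E) (f_convex : econvex f).
Context (f_smooth : essentially_smooth f).
Local Notation F := (fine \o f : R -> R).
Local Notation dom := (effdom f).
Local Notation K := (epi_perspective f).
Local Notation h z := (slack f z).
Implicit Types (v z : 'rV[R]_3) (x y t d : R).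

Let dom0 : dom !=set0.
Proof. by case: f_smooth => -[x /interior_effdom dx] _ _; exists x. Qed.

Definition has_residual_bound z := exists2 C, 0 <= C &
  forall v, K v -> exists2 p, (K `&` orthogonal_to z) p &
    norm1 (v - p) <= C * (inner v z + Num.sqrt (norm1 v * inner v z)).

(** The estimates on coordinates of points of the cone below come largely from pairing with
    well-chosen dual elements, which also covers the points with [v 0 1 = 0]. *)
Lemma dual_ge0 v z : K v -> dual_slack f z -> 0 <= inner v z.
Proof. by move=> Kv /(dual_coneP f_ge0 f_convex dom0); exact. Qed.

Lemma linear_residual_bound z C : 0 <= C -> dual_slack f z ->
  (forall v, K v -> exists2 p, (K `&` orthogonal_to z) p &
    norm1 (v - p) <= C * inner v z) -> has_residual_bound z.
Proof.
move=> C0 Dz H; exists C => // v Kv; have [p Fp vp] := H v Kv.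
by exists p => //; rewrite (le_trans vp)// ler_wpM2l// lerDl sqrtr_ge0.
Qed.

(** The positive lower bound [m] leaves room to perturb the first two coordinates of [z] inside the
    dual cone; pairing with the perturbed vectors bounds [|v 0 0|] and [|v 0 1|] by multiples of
    [inner v z]. The nearby face point is [(0, 0, v 0 2)]. *)
Lemma axis_residual_bound z m : dual_slack f z -> z 0 2 = 0 ->
  z 0 0 != 0 -> 0 < m -> (forall y, dom y -> m <= h z y) ->
  has_residual_bound z.
Proof.
move=> Dz c0 a0 m0 hm.
have na0 : 0 < `|z 0 0| by rewrite normr_gt0.
have mb0 : 0 < m + `|z 0 1| by rewrite ltr_wpDr.
(* From [|a| |y| <= h + |b|] and [m <= h] one gets [m |a| |y| <= (m + |b|) h], that is
   [e * |y| <= h]. *)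
pose e := m * `|z 0 0| / (m + `|z 0 1|).
have e0 : 0 < e by rewrite divr_gt0// mulr_gt0.
have ey y : dom y -> e * `|y| <= h z y.
  move=> dy; have hy := hm y dy.
  have hyE : z 0 0 * y = h z y - z 0 1 by rewrite /slack c0 mul0r addr0 addrK.
  have ay : `|z 0 0| * `|y| <= h z y + `|z 0 1|.
    rewrite -normrM hyE (le_trans (ler_normB _ _))// ger0_norm//; lra.
  rewrite /e mulrAC ler_pdivrMr// -mulrA.
  have := ler_wpM2l (ltW m0) ay; have := normr_ge0 (z 0 1); nra.
have Dpm (s : R) : `|s| = 1 -> dual_slack f (vec3 (z 0 0 + s * e) (z 0 1) 0).
  move=> s1; split; first by rewrite vec3E.
  move=> y dy; rewrite /slack !vec3E mul0r addr0.
  have := ey y dy; rewrite /slack c0 mul0r addr0.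
  have := ler_norm (- (s * (e * y))).
  by rewrite normrN normrM s1 mul1r normrM (gtr0_norm e0); lra.
have Dm : dual_slack f (vec3 (z 0 0) (z 0 1 - m) 0).
  split; first by rewrite vec3E.
  move=> y dy; rewrite /slack !vec3E mul0r addr0.
  by have := hm y dy; rewrite /slack c0 mul0r addr0; lra.
have D01 : dual_slack f (vec3 0 0 1).
  split; first by rewrite vec3E ler01.
  by move=> y _; rewrite /slack !vec3E; have := fine_ge0 f_ge0 y; lra.
have D10 : dual_slack f (vec3 0 1 0).
  split; first by rewrite vec3E.
  by move=> y _; rewrite /slack !vec3E; lra.
apply: (@linear_residual_bound z (e^-1 + m^-1)) => //.
  by rewrite addr_ge0// invr_ge0 ltW.
move=> v Kv.
have r0 := dual_ge0 Kv D01; have t0 := dual_ge0 Kv D10.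
have q1 := dual_ge0 Kv (Dpm 1 (normr1 _)).
have q2 := dual_ge0 Kv (Dpm (-1) (normrN1 _)).
have q3 := dual_ge0 Kv Dm.
rewrite !inner3 !vec3E in r0 t0 q1 q2 q3.
exists (vec3 0 0 (v 0 2)).
  split; first by apply: epi_axis => //; lra.
  by rewrite /orthogonal_to/= inner3 !vec3E c0; ring.
rewrite /norm1 !mxE/= !subr0 subrr normr0 addr0 inner3 c0 mulr0 addr0.
set q := (X in _ <= _ * X).
have xq : `|v 0 0| <= e^-1 * q.
  rewrite mulrC ler_pdivlMr// -[X in _ * X <= _](gtr0_norm e0) -normrM ler_norml.
  by apply/andP; split; rewrite /q; lra.
have tq : `|v 0 1| <= m^-1 * q.
  rewrite mulrC ler_pdivlMr// ger0_norm; last lra.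
  by rewrite /q; lra.
by rewrite mulrDl lerD.
Qed.

(** Subtracting [m] from the second coordinate of [z] bounds [v 0 1]. If [v 0 0] points in direction
    [s], [v] is compared with the face ray there; otherwise a tangent of the slack bounds [v 0 0]
    and [v] is compared with 0. The third coordinate follows from [inner v z]. *)
Lemma recession_residual_bound z m s : dual_slack f z -> 0 < z 0 2 ->
  s = 1 \/ s = -1 -> (forall y, (dom)° y -> s * dslack f z y < 0) ->
  0 < m -> (forall y, dom y -> m <= h z y) -> has_residual_bound z.
Proof.
move=> Dz c0 s1 hneg m0 hm.
have unb := effdom_unbounded f_ge0 f_convex f_smooth c0 s1 hneg.
have ss : s * s = 1 by case: s1 => ->; lra.
(* The slack decreases without end in direction [s], so the increments of [c F] are at most those of
   [- a y]; this is the recession inequality. *)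
have Kray x : 0 <= s * x -> K (vec3 x 0 (- (x * z 0 0 / z 0 2))).
  rewrite le_eqVlt => /predU1P[sx0|sx0].
    have -> : x = 0 by rewrite -[x]mul1r -ss -mulrA -sx0 mulr0.
    by rewrite !mul0r oppr0; exact: epi_axis.
  apply/(epi_perspectiveP f_ge0); right; rewrite !vec3E; split => //.
  apply/(recession_leP f_ge0 f_convex _ _ dom0) => u u1; set y0 := xget _ _.
  have dy0 : dom y0 by apply: xgetPex; exact: dom0.
  have u0 : 0 < u by lra.
  have iu : (dom)° (y0 + u * x).
    have := unb y0 (u * (s * x)) dy0 (mulr_gt0 u0 sx0).
    by rewrite mulrCA [s * (s * x)]mulrA ss mul1r.
  split; first exact: interior_effdom.
  have T := slack_tangent_le f_ge0 f_convex f_smooth (ltW c0) iu dy0.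
  have N : dslack f z (y0 + u * x) * x < 0.
    have := hneg _ iu; set D := dslack _ _ _ => sD.
    by rewrite -[x]mul1r -ss -mulrA mulrA [D * s]mulrC nmulr_rlt0.
  rewrite -(ler_pM2l c0).
  have -> : z 0 2 * (F y0 + u * - (x * z 0 0 / z 0 2)) =
      z 0 2 * F y0 - u * (x * z 0 0) by field; rewrite gt_eqF.
  have := mulr_gt0 u0 (_ : 0 < - (dslack f z (y0 + u * x) * x)).
  by rewrite oppr_gt0 => /(_ N); move: T; rewrite /slack; lra.
have [[x1 i1] _ _] := f_smooth.
(* [k1 - k0 * y] is the tangent of the slack at [x1]; subtracting it from the slack leaves a
   nonnegative function, hence the dual element [D1]. *)
pose k0 := - dslack f z x1; pose k1 := h z x1 + k0 * x1.
have D1 : dual_slack f (vec3 (z 0 0 + k0) (z 0 1 - k1) (z 0 2)).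
  split; rewrite ?vec3E ?ltW// => y dy.
  have := slack_tangent_le f_ge0 f_convex f_smooth (ltW c0) i1 dy.
  by rewrite /k1 /k0 {2}/slack /slack !vec3E; lra.
have kap0 : 0 < s * k0 by rewrite mulrN oppr_gt0 hneg.
have Dm : dual_slack f (vec3 (z 0 0) (z 0 1 - m) (z 0 2)).
  split; rewrite ?vec3E ?ltW// => y dy.
  by have := hm y dy; rewrite /slack !vec3E; lra.
have D10 : dual_slack f (vec3 0 1 0).
  split; first by rewrite vec3E.
  by move=> y _; rewrite /slack !vec3E; lra.
(* [T] and [X] are the factors of [inner v z] bounding [|v 0 1|] and, in the wrong direction,
   [|v 0 0|]; [Rr] bounds the error in the third coordinate. *)
pose T := m^-1; pose X := (1 + `|k1| * T) / (s * k0).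
pose Rr := (1 + `|z 0 0| * X + `|z 0 1| * T) / z 0 2.
have T0 : 0 <= T by rewrite invr_ge0 ltW.
have X0 : 0 <= X by rewrite divr_ge0 ?(ltW kap0)// !addr_ge0// mulr_ge0.
have Rr0 : 0 <= Rr by rewrite divr_ge0 ?(ltW c0)// !addr_ge0// mulr_ge0.
apply: (@linear_residual_bound z (T + X + Rr)) => //; first by rewrite !addr_ge0.
move=> v Kv.
have t0 := dual_ge0 Kv D10; have q1 := dual_ge0 Kv D1.
have q2 := dual_ge0 Kv Dm; have q0 := dual_ge0 Kv Dz.
have qE := inner3 v z.
set q := inner v z in qE q0 *.
rewrite !inner3 !vec3E in t0 q1 q2.
have tq : `|v 0 1| <= T * q.
  rewrite mulrC ler_pdivlMr// ger0_norm; last lra.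
  by rewrite qE; lra.
have bt b : `|b * v 0 1| <= `|b| * T * q.
  by rewrite normrM -mulrA ler_wpM2l.
have [sx|sx] := leP 0 (s * v 0 0).
  exists (vec3 (v 0 0) 0 (- (v 0 0 * z 0 0 / z 0 2))).
    split; first exact: Kray.
    by rewrite /orthogonal_to/= inner3 !vec3E; field; rewrite gt_eqF.
  rewrite /norm1 !mxE/= subrr normr0 add0r subr0 opprK.
  have rq : `|v 0 2 + v 0 0 * z 0 0 / z 0 2| <= Rr * q.
    have -> : v 0 2 + v 0 0 * z 0 0 / z 0 2 = (q - z 0 1 * v 0 1) / z 0 2.
      by rewrite qE; field; rewrite gt_eqF.
    rewrite normrM normfV (gtr0_norm c0) /Rr mulrAC ler_wpM2r ?invr_ge0 ?(ltW c0)//.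
    rewrite (le_trans (ler_normB _ _))// (ger0_norm q0).
    have := bt (z 0 1); have := mulr_ge0 (mulr_ge0 (normr_ge0 (z 0 0)) X0) q0; lra.
  have := mulr_ge0 X0 q0; lra.
have xq : `|v 0 0| <= X * q.
  rewrite /X mulrAC ler_pdivlMr//.
  have -> : `|v 0 0| * (s * k0) = - (v 0 0 * k0).
    have -> : `|v 0 0| = - (s * v 0 0).
      rewrite -(ltr0_norm sx) normrM (_ : `|s| = 1) ?mul1r//.
      by case: s1 => ->; rewrite ?normrN normr1.
    by rewrite mulNr mulrACA ss mul1r.
  have := ler_norm (- (k1 * v 0 1)); rewrite normrN.
  have := bt k1; rewrite qE; lra.
exists 0.
  split; last by rewrite /orthogonal_to/= inner3 !mxE; ring.
  have := Kray 0; rewrite mulr0 lexx !mul0r oppr0 => /(_ isT).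
  by congr (K _); apply: eq_vec3; rewrite vec3E mxE.
rewrite subr0 /norm1.
have rq : `|v 0 2| <= Rr * q.
  have -> : v 0 2 = (q - z 0 0 * v 0 0 - z 0 1 * v 0 1) / z 0 2.
    by rewrite qE; field; rewrite gt_eqF.
  rewrite normrM normfV (gtr0_norm c0) /Rr mulrAC ler_wpM2r ?invr_ge0 ?(ltW c0)//.
  rewrite (le_trans (ler_normB _ _))// (le_trans (lerD (ler_normB _ _) (lexx _)))//.
  rewrite (ger0_norm q0).
  have := bt (z 0 1); have := ler_wpM2l (normr_ge0 (z 0 0)) xq.
  rewrite -[`|z 0 0| * `|v 0 0|]normrM; lra.
lra.
Qed.

End residual_bounds.

Arguments has_residual_bound {R} f z.

(** * Growth of the slack around a minimizer *)

Section strong_convexity.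
Context {R : realType} {f : R -> \bar R} {W : set R}.
Context (f_ge0 : forall x, (0 <= f x)%E) (f_convex : econvex f).
Context (f_smooth : essentially_smooth f) (W_finite : finite_set W).
Context (f_strong : forall C : set R^o, compact C -> convex_set C ->
    C `<=` (effdom f)° `\` W -> strongly_convex_on C (fine \o f)).
Local Notation F := (fine \o f : R -> R).
Local Notation dom := (effdom f).
Local Notation K := (epi_perspective f).
Local Notation h z := (slack f z).
Implicit Types (v z : 'rV[R]_3) (x y t d : R).

Let dom0 : dom !=set0.
Proof. by case: f_smooth => -[x /interior_effdom dx] _ _; exists x. Qed.

Lemma slack_midpoint_lt z l r : 0 < z 0 2 ->
  (forall y, l <= y <= r -> ((dom)° `\` W) y) ->
  exists2 mu, 0 < mu & forall x y, l <= x <= r -> l <= y <= r ->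
    h z ((x + y) / 2) <= (h z x + h z y) / 2 - mu / 2 * (x - y) ^+ 2.
Proof.
move=> c0 lrI; pose C : set R^o := `[l, r]%classic.
have cC : compact C by exact: segment_compact.
have xC : convex_set C.
  move=> x y t; rewrite !inE /C/= !in_itv/= => /andP[lx xr] /andP[ly yr].
  have -> : conv t x y = t%:num * (x : R) + (1 - t%:num) * (y : R) by [].
  have t0 : 0 <= t%:num by []; have t1 : t%:num <= 1 by [].
  by apply/andP; split; nra.
have CI : C `<=` (dom)° `\` W by move=> y; rewrite /C/= in_itv/=; exact: lrI.
have [s s0 sC] := f_strong cC xC CI.
(* At [t = 1/2] strong convexity gains [s / 8] times the squared distance, scaled here by
   [z 0 2]. *)
exists (z 0 2 * s / 4); first by rewrite divr_gt0// mulr_gt0.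
move=> x y lxr lyr.
have := sC x y 2^-1; rewrite /C/= !in_itv/= => /(_ lxr lyr).
have h0 : 0 <= 2^-1 :> R by rewrite invr_ge0.
have h1 : 2^-1 <= 1 :> R by rewrite invf_le1// ler1n.
move=> /(_ h0 h1) /(ler_wpM2l (ltW c0)).
rewrite (_ : 2^-1 * x + (1 - 2^-1) * y = (x + y) / 2); last by lra.
rewrite /slack /=; lra.
Qed.

(** Each point is avoided by keeping the outer third of the interval on the side of the midpoint
    away from it. *)
Lemma subitv_avoid (s : seq R) (p q : R) : p < q -> exists p' q' : R,
  [/\ p <= p', p' < q', q' <= q & forall w, w \in s -> ~ p' <= w <= q'].
Proof.
move=> pq; elim: s => [|w s [p' [q' [pp' pq' qq' ih]]]]; first by exists p, q.
have [wle|wgt] := leP w ((p' + q') / 2).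
  exists ((p' + 2 * q') / 3), q'; split; try lra.
  move=> w'; rewrite inE => /predU1P[-> /andP[]|/ih Nw /andP[w1 w2]]; first lra.
  by apply: Nw; apply/andP; split; lra.
exists p', ((2 * p' + q') / 3); split; try lra.
move=> w'; rewrite inE => /predU1P[-> /andP[]|/ih Nw /andP[w1 w2]]; first lra.
by apply: Nw; apply/andP; split; lra.
Qed.

(** On a subinterval free of [W], if both endpoint values were at most [m], strong convexity would
    put the midpoint value below [m]. *)
Lemma slack_gt_lbound z p q m : 0 < z 0 2 -> (dom)° p -> (dom)° q -> p < q ->
  (forall y, dom y -> m <= h z y) -> exists2 y, p <= y <= q & m < h z y.
Proof.
move=> c0 ip iq pq hm.
have /finite_seqP[s Ws] := W_finite.
have [l [r [pl lr rq av]]] := subitv_avoid s pq.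
have ilr y : l <= y <= r -> (dom)° y.
  move=> /andP[ly yr]; have [yp|yp] := eqVneq y p; first by rewrite yp.
  have [yq|yq] := eqVneq y q; first by rewrite yq.
  apply: (effdom_between f_ge0 f_convex (interior_effdom ip) (interior_effdom iq)).
  by rewrite !lt_neqAle yq eq_sym yp/=; apply/andP; split; lra.
have lrI y : l <= y <= r -> ((dom)° `\` W) y.
  by move=> ly; split; [exact: ilr | rewrite Ws/= => /av; exact].
have [mu mu0 H] := slack_midpoint_lt c0 lrI.
have ll : l <= l <= r by rewrite lexx ltW.
have rr : l <= r <= r by rewrite lexx ltW.
have mid : dom ((l + r) / 2) by apply/interior_effdom/ilr; lra.
have {}H := H l r ll rr; have hm' := hm _ mid.
have sq : 0 < mu / 2 * (l - r) ^+ 2.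
  by rewrite mulr_gt0 ?divr_gt0// exprn_even_gt0//= subr_eq0 lt_eqF.
have [hl|hl] := ltP m (h z l); first by exists l => //; lra.
by exists r; lra.
Qed.

(** The slack exceeds its minimum [m] at some point on each side of [x0], whether or not [x0] is in
    [W]. Chords from [x0] turn this into linear growth, and with [m > 0] the slack dominates a
    multiple of [|y| + 1 + F y]. *)
Lemma minimizer_interior z x0 : 0 < z 0 2 -> (dom)° x0 ->
  dslack f z x0 = 0 -> 0 < h z x0 -> (dual_cone K)° z.
Proof.
move=> c0 i0 h0 m0; have d0 := interior_effdom i0.
set m := h z x0 in m0 *.
have hm y : dom y -> m <= h z y.
  move=> dy; have := slack_tangent_le f_ge0 f_convex f_smooth (ltW c0) i0 dy.
  by rewrite h0 mul0r addr0.
have /nbhs_ballP[e /= e0 be] : nbhs x0 ((dom)°).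
  by apply: open_nbhs_nbhs; split => //; exact: open_interior.
pose dl := e / 2.
have dl0 : 0 < dl by rewrite divr_gt0.
have ib d : `|d| <= dl -> (dom)° (x0 + d).
  move=> dd; apply: be; rewrite /ball/= opprD addNKr normrN.
  by rewrite (le_lt_trans dd)// /dl; lra.
have il : (dom)° (x0 - dl) by apply: ib; rewrite normrN gtr0_norm.
have il2 : (dom)° (x0 - dl / 2) by apply: ib; rewrite normrN gtr0_norm; lra.
have ir : (dom)° (x0 + dl) by apply: ib; rewrite gtr0_norm.
have ir2 : (dom)° (x0 + dl / 2) by apply: ib; rewrite gtr0_norm; lra.
have lt1 : x0 - dl < x0 - dl / 2 by lra.
have lt2 : x0 + dl / 2 < x0 + dl by lra.
have [x1 /andP[x1l x1r] g1] := slack_gt_lbound c0 il il2 lt1 hm.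
have [x2 /andP[x2l x2r] g2] := slack_gt_lbound c0 ir2 ir lt2 hm.
pose g := Num.min (h z x1 - m) (h z x2 - m).
have g0 : 0 < g by rewrite lt_min !subr_gt0 g1.
(* Here [xi] lies between [x0] and [y], so its gain [g] propagates to [y] in proportion to the
   distance. *)
have chord (y xi : R) : dom y -> m + g <= h z xi -> `|xi - x0| <= dl ->
    0 < (xi - x0) / (y - x0) <= 1 -> g * `|y - x0| <= dl * (h z y - m).
  move=> dy gi di /andP[t0 t1].
  have yx0 : y - x0 != 0.
    by apply: contraTneq t0 => ->; rewrite invr0 mulr0 ltxx.
  have t01 : 0 <= (xi - x0) / (y - x0) <= 1 by apply/andP; split => //; exact: ltW.
  have dxy : dom (x0 + (y - x0)) by rewrite subrKC.
  have [_] := slack_chord_le f_ge0 f_convex (ltW c0) d0 dxy t01.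
  rewrite divfK// !subrKC -/m => H.
  have {}H : g <= (xi - x0) / (y - x0) * (h z y - m) by lra.
  have tE : (xi - x0) / (y - x0) = `|xi - x0| / `|y - x0|.
    by rewrite -normfV -normrM gtr0_norm.
  move: H; rewrite tE mulrAC ler_pdivlMr ?normr_gt0// => /le_trans; apply.
  by rewrite ler_wpM2r// subr_ge0 hm.
have growth (y : R) : dom y -> g * `|y - x0| <= dl * (h z y - m) + g * dl.
  move=> dy; have hy := hm y dy.
  have gd : 0 <= g * dl by rewrite mulr_ge0// ltW.
  have [y2|y2] := leP x2 y.
    suff : g * `|y - x0| <= dl * (h z y - m) by lra.
    apply: (chord y x2) => //.
    - by rewrite -lerBrDl ge_min lexx orbT.
    - by rewrite ger0_norm; lra.
    - have y0 : 0 < y - x0 by lra.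
      by rewrite divr_gt0 ?ler_pdivrMr//=; lra.
  have [y1|y1] := leP y x1.
    suff : g * `|y - x0| <= dl * (h z y - m) by lra.
    apply: (chord y x1) => //.
    - by rewrite -lerBrDl ge_min lexx.
    - by rewrite ler0_norm; lra.
    - have y0 : 0 < x0 - y by lra.
      rewrite -[x1 - x0]opprB -[y - x0]opprB invrN mulrNN.
      by rewrite divr_gt0 ?ler_pdivrMr//=; lra.
  have : g * `|y - x0| <= g * dl.
    by rewrite ler_wpM2l ?(ltW g0)// ler_norml; apply/andP; split; lra.
  have := mulr_ge0 (ltW dl0) (_ : 0 <= h z y - m); rewrite subr_ge0 => /(_ hy); lra.
(* [P] is the factor in [|y| <= P * h y]: the additive constant [E] is absorbed through
   [1 <= h y / m]. [Q] collects the bounds on [|y|], 1 and [F y]. *)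
pose E := g * (dl + `|x0|).
pose P := (dl + E / m) / g.
pose Q := P + m^-1 + (1 + `|z 0 0| * P + `|z 0 1| / m) / z 0 2.
have E0 : 0 <= E by rewrite mulr_ge0 ?addr_ge0// ltW.
have P0 : 0 <= P by rewrite divr_ge0 ?(ltW g0)// addr_ge0 ?(ltW dl0)// divr_ge0// ltW.
have Q0 : 0 < Q.
  rewrite /Q ltr_pwDl ?ltr_wpDl ?invr_gt0// divr_ge0 ?(ltW c0)//.
  by rewrite !addr_ge0// mulr_ge0// invr_ge0 ltW.
have Hgrow (y : R) : dom y -> `|y| + 1 + F y <= Q * h z y.
  move=> dy; have hy := hm y dy.
  have h1 : 1 <= m^-1 * h z y by rewrite mulrC ler_pdivlMr// mul1r.
  have Py : `|y| <= P * h z y.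
    rewrite /P mulrAC ler_pdivlMr// mulrC.
    have yx : `|y| <= `|y - x0| + `|x0| by rewrite -[in leLHS](subrK x0 y) ler_normD.
    have := ler_wpM2l (ltW g0) yx; have := growth y dy.
    have := ler_wpM2l E0 h1; rewrite mulrA.
    have := mulr_gt0 dl0 m0; rewrite /E; lra.
  have Fy : F y <= (1 + `|z 0 0| * P + `|z 0 1| / m) / z 0 2 * h z y.
    rewrite mulrAC ler_pdivlMr//.
    have := ler_wpM2l (normr_ge0 (z 0 0)) Py; rewrite -normrM => a1.
    have := ler_norm (- (z 0 0 * y)); rewrite normrN => a2.
    have := ler_norm (- z 0 1); rewrite normrN => a3.
    have := ler_wpM2l (normr_ge0 (z 0 1)) h1; rewrite mulr1 mulrA => a4.
    have hE : h z y = z 0 0 * y + z 0 1 + z 0 2 * F y by [].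
    by move: a1 a4; rewrite !mulrDl; move: (h z y) hE => hh hE; lra.
  by rewrite /Q !mulrDl in Fy *; lra.
apply: (@dual_slack_interior _ _ f_ge0 f_convex dom0 z (Num.min (z 0 2) Q^-1)).
- by rewrite lt_min c0 invr_gt0.
- by rewrite ge_min lexx.
move=> y dy; have Fy0 : 0 <= `|y| + 1 + F y by rewrite !addr_ge0// fine_ge0.
apply: (@le_trans _ _ (Q^-1 * (`|y| + 1 + F y))).
  by rewrite ler_wpM2r// ge_min lexx orbT.
by rewrite mulrC ler_pdivrMr// mulrC Hgrow.
Qed.

(** Write [t = v 0 1], [y = v 0 0 / t] and [q = inner v z], with [t h(y) <= q]. Far from [x0],
    linear growth gives [t |y - x0| = O(q)]. Near [x0], quadratic growth gives
    [mu (t |y - x0|)^2 <= t q <= |v| q], the source of the square root. The face point is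
    [t (x0, 1, F x0)]. *)
Lemma minimizer_residual_bound z x0 : dual_slack f z -> 0 < z 0 2 ->
  (dom)° x0 -> ~ W x0 -> h z x0 = 0 -> has_residual_bound f z.
Proof.
move=> Dz c0 i0 W0 hx0; have d0 := interior_effdom i0.
have [dl dl0 bdl] : exists2 dl, 0 < dl &
    forall y, x0 - dl <= y <= x0 + dl -> ((dom)° `\` W) y.
  have /nbhs_ballP[e /= e0 be] : nbhs x0 ((dom)° `\` W).
    apply: open_nbhs_nbhs; split => //; rewrite setDE.
    apply: openI; first exact: open_interior.
    rewrite openC; apply: (accessible_finite_set_closed.1 _ W W_finite).
    exact/hausdorff_accessible/Rhausdorff.
  exists (e / 2); first by rewrite divr_gt0.
  move=> y yb; apply: be; rewrite /ball/= ltr_norml; lra.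
have [mu mu0 H] := slack_midpoint_lt c0 bdl.
have x0in : x0 - dl <= x0 <= x0 + dl by lra.
(* The midpoint inequality against [x0], where the slack is 0, together with nonnegativity at the
   midpoint. *)
have near (d : R) : `|d| <= dl -> mu * d ^+ 2 <= h z (x0 + d).
  rewrite ler_norml => /andP[d1 d2].
  have dd : x0 - dl <= x0 + d <= x0 + dl by apply/andP; split; lra.
  have := H _ _ dd x0in; rewrite hx0 addr0 (_ : x0 + d - x0 = d); last by lra.
  have : 0 <= h z ((x0 + d + x0) / 2).
    by apply: Dz.2; apply/interior_effdom; apply: (bdl _ _).1; apply/andP; split; lra.
  lra.
have far (y : R) : dom y -> dl <= `|y - x0| -> mu * dl * `|y - x0| <= h z y.
  move=> dy dly; have yx0 : 0 < `|y - x0| by lra.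
  have t01 : 0 <= dl / `|y - x0| <= 1.
    by rewrite divr_ge0 ?(ltW dl0)//= ler_pdivrMr// mul1r.
  have dxy : dom (x0 + (y - x0)) by rewrite subrKC.
  have [_] := slack_chord_le f_ge0 f_convex (ltW c0) d0 dxy t01.
  rewrite subrKC hx0 !subr0.
  have nt : `|dl / `|y - x0| * (y - x0)| = dl.
    by rewrite normrM normrM normfV normr_id divfK ?gt_eqF// gtr0_norm.
  have := near (dl / `|y - x0| * (y - x0)); rewrite nt => /(_ (lexx _)).
  rewrite -real_normK ?num_real// nt => H1 /(le_trans H1).
  by rewrite [dl / _ * _]mulrAC ler_pdivlMr// -(ler_pM2l dl0); lra.
pose k := mu * dl.
have k0 : 0 < k by rewrite mulr_gt0.
have all (y : R) : dom y -> k * (`|y - x0| - dl) <= h z y.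
  move=> dy; have [|] := leP dl `|y - x0|.
    by move=> /(far y dy); rewrite -/k; have := mulr_gt0 k0 dl0; lra.
  move=> lt; apply: (@le_trans _ _ 0); last exact: Dz.2.
  by rewrite pmulr_rle0//; lra.
(* The global linear bound yields two dual elements; for [v 0 1 = 0] they give
   [k * |v 0 0| <= inner v z], where no quotient is available. *)
have Dpm (s : R) : `|s| = 1 -> dual_slack f
    (vec3 (z 0 0 + s * k) (z 0 1 - s * k * x0 + k * dl) (z 0 2)).
  move=> s1; split; rewrite ?vec3E ?(ltW c0)// => y dy.
  have := all y dy; rewrite /slack !vec3E.
  have := ler_norm (- (s * (k * (y - x0)))).
  by rewrite normrN normrM s1 mul1r normrM (gtr0_norm k0); lra.
have D10 : dual_slack f (vec3 0 1 0).
  split; first by rewrite vec3E.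
  by move=> y _; rewrite /slack !vec3E; lra.
pose S := k^-1 + Num.sqrt mu^-1.
have S0 : 0 <= S by rewrite addr_ge0 ?sqrtr_ge0// invr_ge0 ltW.
have aS0 : 0 <= 1 + `|z 0 0| * S by rewrite addr_ge0// mulr_ge0.
exists (S + (1 + `|z 0 0| * S) / z 0 2).
  by rewrite addr_ge0// divr_ge0// ltW.
move=> v Kv.
have t0 := dual_ge0 f_ge0 f_convex f_smooth Kv D10.
have q0 := dual_ge0 f_ge0 f_convex f_smooth Kv Dz.
have q1 := dual_ge0 f_ge0 f_convex f_smooth Kv (Dpm 1 (normr1 _)).
have q2 := dual_ge0 f_ge0 f_convex f_smooth Kv (Dpm (-1) (normrN1 _)).
have qE := inner3 v z; have qS := @epi_slack _ _ f_ge0 v z.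
set q := inner v z in qE q0 qS *; set sq := Num.sqrt _.
have sq0 : 0 <= sq by exact: sqrtr_ge0.
have {}t0 : 0 <= v 0 1 by move: t0; rewrite inner3 !vec3E; lra.
have xS : `|v 0 0 - v 0 1 * x0| <= S * (q + sq).
  move: (t0); rewrite le_eqVlt => /predU1P[t00|tgt0].
    rewrite -t00 mul0r subr0.
    have xq : `|v 0 0| <= k^-1 * q.
      rewrite mulrC ler_pdivlMr// -[X in _ * X <= _](gtr0_norm k0) -normrM.
      rewrite ler_norml; move: q1 q2; rewrite !inner3 !vec3E -t00 !mul0r => q1 q2.
      by rewrite qE -t00; apply/andP; split; lra.
    rewrite (le_trans xq)// /S mulrDl; apply: ler_wpDr.
      by rewrite mulr_ge0 ?sqrtr_ge0 ?addr_ge0.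
    by rewrite ler_wpM2l ?invr_ge0 ?(ltW k0)// lerDl.
  have {}qS := qS tgt0 Kv (ltW c0).
  set y := v 0 0 / v 0 1 in qS.
  have dy : dom y.
    case/(epi_perspectiveP f_ge0): (Kv) => [[_ []]//|[t00]].
    by rewrite t00 ltxx in tgt0.
  have -> : v 0 0 - v 0 1 * x0 = v 0 1 * (y - x0).
    by rewrite mulrBr /y mulrCA divff ?gt_eqF// mulr1.
  rewrite normrM (gtr0_norm tgt0).
  have [lt|le] := leP dl `|y - x0|.
    have xq : v 0 1 * `|y - x0| <= k^-1 * q.
      rewrite mulrC [leRHS]mulrC ler_pdivlMr// (le_trans _ qS)//.
      rewrite mulrAC mulrC ler_pM2l// mulrC; exact: far.
    rewrite (le_trans xq)// /S mulrDl; apply: ler_wpDr.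
      by rewrite mulr_ge0 ?sqrtr_ge0 ?addr_ge0.
    by rewrite ler_wpM2l ?invr_ge0 ?(ltW k0)// lerDl.
  have hy : mu * (y - x0) ^+ 2 <= h z y.
    by have := near _ (ltW le); rewrite subrKC.
  have xq : v 0 1 * `|y - x0| <= Num.sqrt mu^-1 * sq.
    rewrite /sq -sqrtrM ?invr_ge0 ?(ltW mu0)//.
    have v0 : 0 <= v 0 1 * `|y - x0| by rewrite mulr_ge0.
    rewrite -[leLHS]ger0_norm// -sqrtr_sqr ler_wsqrtr//.
    rewrite [leRHS]mulrC ler_pdivlMr//.
    have -> : (v 0 1 * `|y - x0|) ^+ 2 * mu = v 0 1 * (v 0 1 * (mu * (y - x0) ^+ 2)).
      by rewrite exprMn real_normK ?num_real//; ring.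
    have md0 : 0 <= mu * (y - x0) ^+ 2 by rewrite mulr_ge0 ?sqr_ge0// ltW.
    apply: ler_pM => //; first exact: mulr_ge0.
      rewrite /norm1 (ger0_norm t0).
      by have := normr_ge0 (v 0 0); have := normr_ge0 (v 0 2); lra.
    by rewrite (le_trans _ qS)// ler_wpM2l.
  rewrite (le_trans xq)// /S mulrDl -[leLHS]add0r lerD//.
    by rewrite mulr_ge0 ?invr_ge0 ?addr_ge0// ltW.
  by rewrite ler_wpM2l ?sqrtr_ge0// lerDr.
exists (vec3 (v 0 1 * x0) (v 0 1) (v 0 1 * F x0)).
  split; first exact: epi_scale.
  rewrite /orthogonal_to/= inner3 !vec3E.
  transitivity (v 0 1 * h z x0); last by rewrite hx0 mulr0.
  by rewrite /slack /=; ring.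
have rS : `|v 0 2 - v 0 1 * F x0| <= (1 + `|z 0 0| * S) / z 0 2 * (q + sq).
  rewrite mulrAC ler_pdivlMr// -[X in _ * X <= _](gtr0_norm c0) -normrM.
  have -> : (v 0 2 - v 0 1 * F x0) * z 0 2 = q - z 0 0 * (v 0 0 - v 0 1 * x0).
    transitivity (q - z 0 0 * (v 0 0 - v 0 1 * x0) - v 0 1 * h z x0).
      by rewrite qE /slack /=; ring.
    by rewrite hx0 mulr0 subr0.
  rewrite (le_trans (ler_normB _ _))// (ger0_norm q0) normrM.
  by have := ler_wpM2l (normr_ge0 (z 0 0)) xS; lra.
by rewrite /norm1 !mxE/= subrr normr0 addr0 mulrDl lerD.
Qed.

End strong_convexity.

(** * Exceptional rays *)

Section exceptional_rays.
Context {R : realType} {f : R -> \bar R}.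
Context (f_ge0 : forall x, (0 <= f x)%E) (f_convex : econvex f).
Context (f_smooth : essentially_smooth f).
Local Notation dom := (effdom f).
Local Notation h z := (slack f z).
Implicit Types (z : 'rV[R]_3) (s : R).

Definition slack_inf0 z := forall e, 0 < e -> exists2 y, dom y & h z y < e.

Lemma slack_inf0_or_lbound z :
  slack_inf0 z \/ exists2 m, 0 < m & forall y, dom y -> m <= h z y.
Proof.
have [inf0|/existsNP[m /not_implyP[m0 Nm]]] := pselect (slack_inf0 z); first by left.
right; exists m => // y dy; rewrite leNgt; apply/negP => ym.
by apply: Nm; exists y.
Qed.

(** The two slacks differ, after scaling by [l], by a constant, and two nonnegative functions of
    infimum 0 leave no room for a nonzero one. *)
Lemma slack_inf0_unique z z' l : dual_slack f z ->
  dual_slack f z' -> slack_inf0 z -> slack_inf0 z' -> 0 < l ->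
  z' 0 0 = l * z 0 0 -> z' 0 2 = l * z 0 2 -> z' = l *: z.
Proof.
move=> [_ Dz] [_ Dz'] iz iz' l0 e0 e2.
have hE y : h z' y = l * h z y + (z' 0 1 - l * z 0 1).
  by rewrite /slack e0 e2; ring.
suff k0 : z' 0 1 = l * z 0 1 by apply: eq_vec3; rewrite mxE.
apply/eqP; rewrite eq_le; apply/andP; split; rewrite leNgt; apply/negP => lt.
- have [|y dy] := iz' (z' 0 1 - l * z 0 1); first by rewrite subr_gt0.
  by have := mulr_ge0 (ltW l0) (Dz _ dy); rewrite hE; lra.
- have [|y dy] := iz ((l * z 0 1 - z' 0 1) / l); first by rewrite divr_gt0 ?subr_gt0.
  by have := Dz' _ dy; rewrite hE ltr_pdivlMr//; lra.
Qed.

Lemma finely_coverable_proportional n (s : R) (B : set 'rV[R]_n) : 1 < s ->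
  (forall x y, B x -> B y -> exists2 l : R, 0 <= l & y = l *: x) ->
  finely_coverable s B.
Proof.
move=> s1 HB; have [->|/set0P[x Bx]] := eqVneq B set0.
  by apply: finely_coverable0; lra.
by apply: (@finely_coverable_ray _ _ s B x s1) => y By; exact: HB.
Qed.

Definition vertical_set : set 'rV[R]_3 :=
  [set z | [/\ dual_slack f z, z 0 0 = 0 & z 0 2 = 0]].

Lemma vertical_set_coverable s : 1 < s -> finely_coverable s vertical_set.
Proof.
move=> s1; apply: (@finely_coverable_ray _ _ s _ (vec3 0 1 0) s1).
move=> z [[_ Dz] a0 c0].
have [[x /interior_effdom dx] _ _] := f_smooth.
exists (z 0 1); last by apply: eq_vec3; rewrite mxE vec3E ?mulr0 ?mulr1.
by have := Dz _ dx; rewrite /slack a0 c0 !mul0r add0r addr0.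
Qed.

(** Fixing the sign of [z 0 0] makes any two elements positive multiples of each other, so each sign
    gives one ray. *)
Definition axis_set s : set 'rV[R]_3 :=
  [set z | [/\ dual_slack f z, slack_inf0 z, z 0 2 = 0 & 0 < s * z 0 0]].

Lemma axis_set_coverable s s' : 1 < s -> finely_coverable s (axis_set s').
Proof.
move=> s1; apply: finely_coverable_proportional => //.
move=> z z' [Dz iz c0 a0] [Dz' iz' c0' a0'].
have l0 : 0 < (s' * z' 0 0) / (s' * z 0 0) by rewrite divr_gt0.
exists ((s' * z' 0 0) / (s' * z 0 0)); first exact: ltW.
apply: (slack_inf0_unique (z := z)) => //; last by rewrite c0 c0' mulr0.
move: a0; rewrite lt0r mulf_eq0 negb_or => /andP[/andP[s0 z0] _].
by field; rewrite s0 z0.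
Qed.

Definition monotone_set s : set 'rV[R]_3 :=
  [set z | [/\ dual_slack f z, slack_inf0 z, 0 < z 0 2 &
               forall y, (dom)° y -> s * dslack f z y < 0]].

(* Along the unbounded direction [s] both slacks stay bounded, so their slopes
   at infinity agree up to scaling. *)
Lemma monotone_set_coverable s s' : 1 < s -> s' = 1 \/ s' = -1 ->
  finely_coverable s (monotone_set s').
Proof.
move=> s1 ss'; apply: finely_coverable_proportional => //.
move=> z z' [Dz iz c0 hz] [Dz' iz' c0' hz'].
have l0 : 0 < z' 0 2 / z 0 2 by rewrite divr_gt0.
exists (z' 0 2 / z 0 2); first exact: ltW.
apply: (slack_inf0_unique (z := z)) => //; last by rewrite divfK// gt_eqF.
set l := z' 0 2 / z 0 2 in l0 *.
have cl : z' 0 2 = l * z 0 2 by rewrite divfK// gt_eqF.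
have [[x0 i0] _ _] := f_smooth; have d0 := interior_effdom i0.
have iu (u : R) : 0 < u -> (dom)° (x0 + s' * u).
  by move=> u0; exact: (effdom_unbounded f_ge0 f_convex f_smooth c0 ss' hz).
have decr (w : 'rV[R]_3) (u : R) : 0 < w 0 2 ->
    (forall y, (dom)° y -> s' * dslack f w y < 0) -> 0 < u ->
    h w (x0 + s' * u) <= h w x0.
  move=> w0 hw u0.
  have := slack_tangent_le f_ge0 f_convex f_smooth (ltW w0) (iu u u0) d0.
  have := mulr_gt0 u0 (_ : 0 < - (s' * dslack f w (x0 + s' * u))).
  by rewrite oppr_gt0 => /(_ (hw _ (iu u u0))); lra.
have bnd (u : R) : 0 < u -> `|h z' (x0 + s' * u) - l * h z (x0 + s' * u)| <=
    h z' x0 + l * h z x0.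
  move=> u0; have du := interior_effdom (iu u u0).
  have := Dz.2 _ du; have := Dz'.2 _ du.
  have := decr z u c0 hz u0; have := decr z' u c0' hz' u0.
  move=> A1 /(ler_wpM2l (ltW l0)) A2 A3 /(mulr_ge0 (ltW l0)) A4.
  by rewrite ler_norml; apply/andP; split; lra.
apply/eqP; rewrite -subr_eq0; apply: contrapT => /negP k0.
set k := z' 0 0 - l * z 0 0 in k0.
have nk : 0 < `|k| by rewrite normr_gt0.
pose M := h z' x0 + l * h z x0; pose k1 := z' 0 1 - l * z 0 1.
have M0 : 0 <= M := addr_ge0 (Dz'.2 _ d0) (mulr_ge0 (ltW l0) (Dz.2 _ d0)).
(* Chosen so that [|k| * u] exceeds the bound [M] by 1 even after losing the constant term
   [k * x0 + k1]. *)
pose u := (M + `|k * x0 + k1| + 1) / `|k|.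
have u0 : 0 < u by rewrite divr_gt0// ltr_wpDl// addr_ge0.
have := bnd u u0; rewrite -/M.
have -> : h z' (x0 + s' * u) - l * h z (x0 + s' * u) =
    s' * (k * u) + (k * x0 + k1) by rewrite /slack /k /k1 cl; ring.
have uE : `|s' * (k * u)| = M + `|k * x0 + k1| + 1.
  rewrite normrM (_ : `|s'| = 1) ?mul1r; last first.
    by case: ss' => ->; rewrite ?normrN normr1.
  by rewrite normrM (gtr0_norm u0) /u mulrC divfK// gt_eqF.
have := ler_normB (s' * (k * u) + (k * x0 + k1)) (k * x0 + k1).
by rewrite addrK uE; lra.
Qed.

Definition touching_set (x : R) : set 'rV[R]_3 :=
  [set z : 'rV[R]_3 | [/\ 0 < z 0 2, h z x = 0 & dslack f z x = 0]].

(** The two linear equations determine [z 0 0] and [z 0 1] as multiples of [z 0 2]. *)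
Lemma touching_set_coverable s (x : R) : 1 < s -> finely_coverable s (touching_set x).
Proof.
move=> s1; apply: finely_coverable_proportional => //.
move=> z z' [c0 hz dz] [c0' hz' dz'].
have zc : z 0 2 != 0 by rewrite gt_eqF.
exists (z' 0 2 / z 0 2); first by rewrite divr_ge0 ?ltW.
have a0 (w : 'rV[R]_3) : dslack f w x = 0 -> w 0 0 = - (w 0 2 * fderiv f x).
  by move=> /eqP; rewrite addr_eq0 => /eqP.
have b0 (w : 'rV[R]_3) : h w x = 0 -> w 0 1 = - (w 0 0 * x) - w 0 2 * (fine \o f) x.
  by rewrite /slack; lra.
by apply: eq_vec3; rewrite mxE ?b0// ?a0//; field.
Qed.

End exceptional_rays.

Arguments vertical_set {R} f.
Arguments axis_set {R} f s.
Arguments monotone_set {R} f s.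
Arguments touching_set {R} f x.

Theorem theorem5p4 (R : realType) (f : R -> \bar R) (W : set R)
  (f_ge0 : forall x, (0 <= f x)%E)
  (f_proper : proper_efun f)
  (f_closed : lower_semicontinuous f)
  (f_convex : econvex f)
  (f_smooth : essentially_smooth f)
  (W_finite : finite_set W)
  (W_sub : W `<=` (effdom f)°)
  (f_strong : forall C : set R^o, compact C -> convex_set C ->
    C `<=` (effdom f)° `\` W -> strongly_convex_on C (fine \o f))
  (f_lip : forall C : set R^o, convex_set C ->
    C `<=` (effdom f)° `\` W -> locally_lipschitz_on C (fderiv f))
  (s : R) (s_gt1 : 1 < s) :
  let K := epi_perspective f in
  exists2 A : set 'rV[R]_3, hausdorff_measure s A = 0%E &
    forall z, bdry (dual_cone K) z -> ~ A z ->
      exists2 psi : R -> R -> R, is_1FRF K z psi & hoelderian (1 / 2) psi.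
Proof.
move=> K.
have dom0 : effdom f !=set0 := f_proper.1.
have /finite_seqP[r WE] := W_finite.
have or1 : (1 : R) = 1 \/ (1 : R) = -1 by left.
have orN1 : (-1 : R) = 1 \/ (-1 : R) = -1 by right.
exists (vertical_set f `|`
  (axis_set f 1 `|` axis_set f (-1)) `|`
  (monotone_set f 1 `|` monotone_set f (-1)) `|`
  \bigcup_(x in [set` r]) touching_set f x).
  apply: finely_coverable_null; apply: finely_coverableU; last first.
    apply: finely_coverable_bigcup; first lra.
    by move=> x; exact: touching_set_coverable.
  apply: finely_coverableU.
    apply: finely_coverableU; first exact: vertical_set_coverable.
    by apply: finely_coverableU; exact: axis_set_coverable.
  by apply: finely_coverableU; exact: monotone_set_coverable.
move=> z [clz Niz] NAz.
have Dz : dual_slack f z by apply: dual_slack_closed.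
suff [C C0 HC] : has_residual_bound f z.
  apply: residual_of_bound C0 HC _ => v Kv.
  exact: dual_ge0 Dz.
move: (Dz.1); rewrite le_eqVlt => /predU1P[/esym c0|c0].
  have a0 : z 0 0 != 0.
    by apply/eqP => a0; apply: NAz; left; left; left.
  have [iz|[m m0 hm]] := slack_inf0_or_lbound (f := f) z; last first.
    exact: (axis_residual_bound f_ge0 f_convex f_smooth Dz c0 a0 m0 hm).
  exfalso; apply: NAz; left; left; right.
  have [a1|a1|a1] := ltgtP (z 0 0) 0.
  - by right; split => //; rewrite mulN1r oppr_gt0.
  - by left; split => //; rewrite mul1r.
  - by rewrite a1 eqxx in a0.
have monotone s' : s' = 1 \/ s' = -1 ->
    (forall y, (effdom f)° y -> s' * dslack f z y < 0) ->
    has_residual_bound f z.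
  move=> s'1 hz.
  have [iz|[m m0 hm]] := slack_inf0_or_lbound (f := f) z; last first.
    exact: (recession_residual_bound f_ge0 f_convex f_smooth Dz c0 s'1 hz m0 hm).
  exfalso; apply: NAz; left; right.
  by case: s'1 hz => -> hz; [left|right].
have [[x0 i0 h0]|N0] := pselect (exists2 x, (effdom f)° x & dslack f z x = 0).
  have : 0 <= slack f z x0 by apply: Dz.2; exact: interior_effdom.
  rewrite le_eqVlt => /predU1P[/esym hx0|hx0].
    have [Wx0|Wx0] := pselect (W x0).
      by exfalso; apply: NAz; right; exists x0; rewrite -?WE.
    exact: (minimizer_residual_bound f_ge0 f_convex f_smooth W_finite f_strong
      Dz c0 i0 Wx0 hx0).
  exfalso; apply: Niz.
  exact: (minimizer_interior f_ge0 f_convex f_smooth W_finite f_strong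
    c0 i0 h0 hx0).
(* Without a critical point, [slack_minimizer] forbids a change of sign of the slope, so one of the
   two monotone cases applies. *)
have [neg|/existsNP[x2 /not_implyP[i2 /negP]]] :=
    pselect (forall y, (effdom f)° y -> dslack f z y < 0).
  by apply: (monotone 1) => // y iy; rewrite mul1r neg.
rewrite -leNgt => h2.
apply: (monotone (-1)) => // y iy; rewrite mulN1r oppr_lt0 ltNge.
apply/negP => h1; apply: N0.
move: h1; rewrite le_eqVlt => /predU1P[h1|h1]; first by exists y.
move: h2; rewrite le_eqVlt => /predU1P[h2|h2]; first by exists x2.
exact: (slack_minimizer f_ge0 f_convex f_smooth c0 iy i2 h1 h2).
Qed.
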